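(* Let $n\in\mathbb{N}$, $P_1,\ldots,P_n\in\mathcal{P}_3$, let $E$ be a Banach space with norm $|\cdot|$, and let $f\in\mathcal{C}^{2,1}(\mathbb{R},E)$. Put $\sigma_i:=\sigma(P_i)$, $Q_i:=\frac12(\delta_{-\sigma_i}+\delta_{\sigma_i})$, $\sigma:=\big(\sum_{i=1}^n\sigma_i^2\big)^{1/2}$, and $\varrho_i:=\varrho(P_i)$. Then $$\left|\widetilde{\mathop{\ast}_{i=1}^n P_i}\,f-\widetilde{\mathop{\ast}_{i=1}^n Q_i}\,f\right|\ \le\ \frac{\|f''\|_{\mathrm{L}}}{6}\sum_{i=1}^n\frac{\sigma_i^3}{\sigma^3}B(\varrho_i).$$ If each $P_i$ is a two-point law, if the centred third moments $\int (x-\mu(P_i))^3\,dP_i(x)$ are all $\ge0$ or all $\le 0$, and if also $f(x)=cx^3$ for $x\in\mathbb{R}$ with a constant $c\in E$, then equality holds in this inequality.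
   Context: $\mathcal{P}_3$ is the set of all probability laws $P$ on $\mathbb{R}$ with $\int|x|^3\,dP(x)<\infty$ and variance $\sigma^2(P)>0$; $\mu(P)$ is the mean and $\sigma(P)$ the standard deviation. For such $P$, the standardization $\widetilde P$ is the image of $P$ under $x\mapsto (x-\mu(P))/\sigma(P)$, and $\varrho(P):=\int\left|\frac{x-\mu(P)}{\sigma(P)}\right|^3dP(x)\ (\ge 1)$. $\mathop{\ast}_{i=1}^nP_i$ is the convolution of $P_1,\ldots,P_n$; $\delta_a$ is the one-point law at $a$; $Pf:=\int f\,dP$. $B(\rho):=\sqrt{\tfrac12\rho^2+\tfrac12\rho\sqrt{\rho^2+8}-2}$ for $\rho\in[1,\infty[$. Banach spaces are over $\mathbb{R}$ or $\mathbb{C}$. $\mathcal{C}^{2,1}(\mathbb{R},E)$ is the set of twice continuously differentiable $f:\mathbb{R}\to E$ whose second derivative has finite Lipschitz constant $\|f''\|_{\mathrm{L}}:=\sup_{x\ne y}\frac{|f''(x)-f''(y)|}{|x-y|}$. *)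

(* Defs.v *)
From HB Require Import structures.
From mathcomp Require Import all_boot all_order all_algebra.
From mathcomp Require Import all_classical all_reals all_analysis.
From mathcomp Require Import measurable_realfun.
From mathcomp Require Import complex.

Set Implicit Arguments.
Unset Strict Implicit.
Unset Printing Implicit Defensive.

Import Order.TTheory GRing.Theory Num.Theory.
Import numFieldNormedType.Exports.

Local Open Scope ring_scope.
Local Open Scope classical_set_scope.

(* A complex Banach space as a real one: same vectors, scalars restricted to
   the reals, and the norm (which lives in R[i]) read off in R.  All the notions
   below (derivatives, integrals, x ^+ 3 *: c) only use real scalars. *)
Definition realification (R : realType) (E : completeNormedModType R[i]) : Type
  := E.

Section realification.
Context (R : realType) (E : completeNormedModType R[i]).
Local Notation V := (realification E).
Local Open Scope complex_scope.

HB.instance Definition _ := GRing.Zmodule.copy V E.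

Let scale (a : R) (x : V) : V := a%:C *: (x : E).

Let scaleA a b x : scale a (scale b x) = scale (a * b) x.
Proof. by rewrite /scale scalerA rmorphM. Qed.

Let scale1 : left_id 1 scale.
Proof. by move=> x; rewrite /scale rmorph1 scale1r. Qed.

Let scaleDr : right_distributive scale +%R.
Proof. by move=> a x y; rewrite /scale scalerDr. Qed.

Let scaleDl x : {morph scale^~ x : a b / a + b}.
Proof. by move=> a b; rewrite /scale rmorphD scalerDl. Qed.

HB.instance Definition _ := GRing.Zmodule_isLmodule.Build R V
  scaleA scale1 scaleDr scaleDl.

Let norm (x : V) : R := complex.Re `|x : E|.

Let normC (x : E) : `|x| = (norm x)%:C.
Proof.
by rewrite /norm; have /complex_realP[r ->] := normr_real x.
Qed.

Let norm_ler_normD (x y : V) : norm (x + y) <= norm x + norm y.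
Proof.
by have := ler_normD (x : E) (y : E); rewrite !normC -rmorphD/= lecR.
Qed.

Let norm_normrZ (a : R) (x : V) : norm (a *: x) = `|a| * norm x.
Proof.
apply: complexI; rewrite rmorphM/= -!normC.
by rewrite [LHS](normrZ a%:C (x : E)) normc_def/= expr0n addr0 sqrtr_sqr.
Qed.

Let norm_normr0_eq0 (x : V) : norm x = 0 -> x = 0.
Proof. by move=> x0; apply/eqP; rewrite -(normr_eq0 (x : E)) normC x0. Qed.

HB.instance Definition _ := Lmodule_isNormed.Build R V
  norm_ler_normD norm_normrZ norm_normr0_eq0.

Let realification_complete (F : set_system V) :
  ProperFilter F -> cauchy F -> cvg F.
Proof.
move=> FF /cauchy_ballP Fc.
have Fc' : @cauchy E F.
  apply/(@cauchy_ballP _ E) => e e0.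
  have [r re] : exists r : R, e = r%:C by apply/complex_realP/gtr0_real.
  have r0 : 0 < r by move: e0; rewrite re ltcR.
  apply: filterS (Fc r r0) => -[x y]/=.
  by rewrite re -!ball_normE/= normC ltcR.
have /cvg_ex[l Fl] := @cauchy_cvg E F FF Fc'; apply/cvg_ex; exists l.
apply/cvgrPdist_lt => e e0.
have ec0 : 0 < e%:C by rewrite ltcR.
move/(@cvgrPdist_lt _ E) : Fl => /(_ _ ec0).
apply: filterS => x.
by rewrite normC ltcR.
Qed.

HB.instance Definition _ := Uniform_isComplete.Build V realification_complete.

End realification.

Inductive banachSpace (R : realType) :=
| RealBanach of completeNormedModType R
| ComplexBanach of completeNormedModType R[i].

Definition real_banach (R : realType) (E : banachSpace R) :
    completeNormedModType R :=
  match E with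
  | RealBanach E => E
  | ComplexBanach E => realification E
  end.
Coercion real_banach : banachSpace >-> CompleteNormedModule.type.

Section bochner.
Context d (T : measurableType d) (R : realType) (P : probability T R)
  (E : completeNormedModType R).

Definition simple_fun (s : T -> E) :=
  finite_set (range s) /\ forall v, measurable (s @^-1` [set v]).

Definition simple_integral (s : T -> E) : E :=
  \sum_(v \in range s) fine (P (s @^-1` [set v])) *: v.

(* The pointwise convergence makes f strongly measurable, and hence
   the integrands `|f x - s k x| measurable. *)
Definition is_bochner_integral (f : T -> E) (I : E) :=
  exists s : nat -> T -> E,
    [/\ forall k, simple_fun (s k),
        forall x, s k x @[k --> \oo] --> f x,
        (\int[P]_x (`|f x - s k x|)%:E)%E @[k --> \oo] --> 0%E
      & simple_integral (s k) @[k --> \oo] --> I].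

Definition bochner_integrable (f : T -> E) :=
  exists I, is_bochner_integral f I.

(* The integral is unique when it exists; the value is 0 when it does not. *)
Definition bochner_integral (f : T -> E) : E :=
  xget 0 [set I | is_bochner_integral f I].

End bochner.

Section C21.
Context (R : realType) (E : normedModType R).

Definition lipschitz_seminorm (g : R -> E) : \bar R :=
  ereal_sup [set (`|g p.1 - g p.2| / `|p.1 - p.2|)%:E
            | p in [set p : R * R | p.1 != p.2]].

Definition C21 (f : R -> E) :=
  [/\ forall x, derivable f x 1,
      forall x, derivable f^`() x 1,
      continuous f^`(2)
    & (lipschitz_seminorm f^`(2) < +oo)%E].

End C21.

Notation law R := (probability (measurableTypeR R) R).

Section laws.
Context (R : realType).
Implicit Types P Q : law R.

Definition mean P : R := fine 'E_P[fun x => x].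

Definition stddev P : R := Num.sqrt (fine 'V_P[fun x => x]).

Definition P3 P :=
  ('E_P[fun x => (`|x| ^+ 3)%R] < +oo)%E /\ (0 < 'V_P[fun x => x])%E.

Definition std_abs_moment3 P : R :=
  fine 'E_P[fun x => `|(x - mean P) / stddev P| ^+ 3].

Definition centred_moment3 P : R := fine 'E_P[fun x => (x - mean P) ^+ 3].

Definition affine_std (m s : R) (x : measurableTypeR R) : measurableTypeR R :=
  (x - m) / s.

Let measurable_affine_std m s : measurable_fun setT (affine_std m s).
Proof.
by apply: measurable_funM => //; apply: measurable_funB.
Qed.

HB.instance Definition _ m s :=
  isMeasurableFun.Build _ _ _ _ (affine_std m s) (measurable_affine_std m s).

Definition standardize P : law R :=
  distribution P (affine_std (mean P) (stddev P)).

Definition addition (x : measurableTypeR R * measurableTypeR R) :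
  measurableTypeR R := x.1 + x.2.

Let measurable_addition : measurable_fun setT addition.
Proof. by apply: measurable_funD. Qed.

HB.instance Definition _ :=
  isMeasurableFun.Build _ _ _ _ addition measurable_addition.

Definition convolution P Q : law R := distribution (P \x Q)%E addition.

Definition point_law (a : R) : law R := @dirac _ (measurableTypeR R) a R.

Definition convolutions n (P : 'I_n -> law R) : law R :=
  \big[convolution/point_law 0]_(i < n) P i.

Definition symmetric_measure (s : R) :=
  mscale (2^-1)%:nng (measure_add (point_law (- s)) (point_law s)).

HB.instance Definition _ s := Measure.on (symmetric_measure s).

Let symmetric_measureT s : symmetric_measure s setT = 1%E.
Proof.
have -> : symmetric_measure s setT = (2^-1%:E * (1 + 1))%E.
  congr (_ * _)%E; rewrite [LHS](measure_addE (point_law (- s)) (point_law s)).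
  by congr (_ + _)%E; exact: probability_setT.
by rewrite -EFinD -EFinM -[1 + 1]/2%:R mulVf.
Qed.

HB.instance Definition _ s := Measure_isProbability.Build _ _ _
  (symmetric_measure s) (symmetric_measureT s).

Definition symmetric_law (s : R) : law R := symmetric_measure s.

Definition two_point_law P :=
  exists a b p : R, [/\ a != b, 0 < p < 1 &
    forall A, measurable A ->
      P A = (p%:E * point_law a A + (1 - p)%:E * point_law b A)%E].

Definition B (rho : R) : R :=
  Num.sqrt (rho ^+ 2 / 2 + rho / 2 * Num.sqrt (rho ^+ 2 + 8) - 2).

End laws.

(* Main.v *)
(* A Lindeberg replacement argument reduces the inequality to one summand.
   Composing with a norming functional (Hahn-Banach) makes [f] real-valued.

   For one standardized law [P] with third absolute moment [rho], [f] is bounded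
   by a function [a + b x + c x^2 + d |x|^3] with [d >= L / 6] touching [f] at
   both atoms of a standardized two-point law [T].  As [d] is that large, the
   derivative of the difference is convex on either half-line, once the negative
   one is reflected, so double contact at the atoms forces the difference to be
   nonnegative.
   Integrating gives [P f <= T f + d (rho - rho_T)], and [T f] exceeds the
   symmetric two-point value by at most [L / 6] times the absolute value of its
   third moment, by a quadratic-plus-cubic majorant again.  If neither two-point law
   with the given [rho], nor its reflection, admits such a contact, the
   intermediate value theorem yields one with smaller [rho_T] and [d = L / 6],
   which is enough since [B] grows at least as fast as [rho]. *)

Require Import Defs.
From HB Require Import structures.
From mathcomp Require Import all_boot all_order all_algebra.
From mathcomp Require Import all_classical all_reals all_analysis.
From mathcomp Require Import measurable_realfun finmap ring lra.

Set Implicit Arguments.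
Unset Strict Implicit.
Unset Printing Implicit Defensive.

Import Order.TTheory GRing.Theory Num.Theory.
Import numFieldNormedType.Exports.

Local Open Scope ring_scope.
Local Open Scope classical_set_scope.

(** * One-variable majorants *)

Section touching.
Context {R : realType}.
Implicit Types (f df r dr : R -> R) (a u x y z d L : R).

(** First-order contact at two atoms [u] and [- v] imposes four conditions on [a], [b], [c], [d].
    When [u <> v] this forces [d]: it is the quotient of the values that [hermite_defect] takes at
    [f] and at [|x|^3]. Nothing makes this quotient reach [L / 6], and that is the obstacle. The
    defect of [|x|^3] is odd in the third moment [w = u - v]. Hence, with [phi] the defect of [f]
    minus [L / 6] times that of [|x|^3], the law with third moment [w > 0] works if [phi w >= 0],
    and its reflection if [phi (- w) <= 0]. If both fail, [phi] changes sign between [- w] and [w],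
    and at a zero [d = L / 6] is admissible.

    [B] inverts the map from the third moment [w >= 0] of a standardized two-point law to its third
    absolute moment, [(w ^ 2 + 2) / sqrt (w ^ 2 + 4)]. This map has slope at most 1, so replacing
    third moment [t] by [w] costs at most [L / 6 * (w - |t|)], which the bound on the third-moment
    term leaves free. At [rho = 1] the law is symmetric and the defect of [|x|^3] vanishes;
    therefore the estimate is proved for every [w > B rho], and [w] then tends to [B rho]. *)

Lemma MVT_global f df a b : a < b -> (forall x, is_derive x 1 f (df x)) ->
  exists c, [/\ a < c, c < b & f b - f a = df c * (b - a)].
Proof.
move=> ab fdf.
have cf : continuous f.
  by move=> x; apply/differentiable_continuous/derivable1_diffP; case: (fdf x).
have [|c] := @MVT R f df a b ab (fun x _ => fdf x).
  exact: continuous_subspaceT.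
by rewrite in_itv/= => /andP[ac cb] E; exists c.
Qed.

Definition convex_from a (g : R -> R) := forall x y z, a <= x -> x < y -> y < z ->
  (z - x) * g y <= (z - y) * g x + (y - x) * g z.

(** If [r x < 0], the mean value theorem on the two intervals cut out by [a], [u] and [x] gives
    derivative values that break convexity: of signs [-], [+], [0] when [x < u], and [<= 0], [0],
    [< 0] when [u < x]. *)
Lemma touching_ge0 r dr a u : a < u -> (forall x, is_derive x 1 r (dr x)) ->
  convex_from a dr -> 0 <= r a -> r u = 0 -> dr u = 0 ->
  forall x, a <= x -> 0 <= r x.
Proof.
move=> au rdr cvx ra ru dru x ax; rewrite leNgt; apply/negP => rx.
have {ax} ax : a < x by rewrite lt_neqAle ax andbT; apply/eqP => E; move: rx ra;
  rewrite E; lra.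
have [xu|ux|xu] := ltgtP x u; last by move: rx; rewrite xu ru ltxx.
  have [y1 [ay1 y1x E1]] := MVT_global ax rdr.
  have [y2 [xy2 y2u E2]] := MVT_global xu rdr.
  have := cvx y1 y2 u (ltW ay1) (lt_trans y1x xy2) y2u; rewrite dru.
  have : dr y1 < 0 by nra.
  have : 0 < dr y2 by nra.
  move=> d2 d1.
  have : 0 < (u - y1) * dr y2 by nra.
  have : (u - y2) * dr y1 <= 0 by nra.
  lra.
have [y1 [ay1 y1u E1]] := MVT_global au rdr.
have [y2 [uy2 y2x E2]] := MVT_global ux rdr.
have := cvx y1 u y2 (ltW ay1) y1u uy2; rewrite dru.
have d1 : dr y1 <= 0 by nra.
have d2 : dr y2 < 0 by nra.
have : (y2 - u) * dr y1 <= 0 by nra.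
have : (u - y1) * dr y2 < 0 by nra.
lra.
Qed.

(** Covers a negative start, which [touching_ge0] leaves out: [r] must rise to reach 0, and
    convexity moves the positive slope back to [a]. Applied to a function and its reflection, whose
    slopes at 0 are opposite, it gives a contradiction. *)
Lemma touching_deriv_gt0 r dr a u : a < u -> (forall x, is_derive x 1 r (dr x)) ->
  convex_from a dr -> r a < 0 -> r u = 0 -> dr u = 0 -> 0 < dr a.
Proof.
move=> au rdr cvx ra ru dru.
have [y [ay yu E]] := MVT_global au rdr.
have := cvx a y u (lexx _) ay yu; rewrite dru mulr0 addr0.
have d1 : 0 < dr y by nra.
move=> h; have : 0 < (u - y) * dr a by nra.
by rewrite pmulr_rgt0 // subr_gt0.
Qed.

(* The last clause bounds the second divided differences of [df] by [L / 2]; it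
   says that [f''] is [L]-Lipschitz without mentioning [f'']. *)
Definition cubic_smooth L f df := [/\ forall x, is_derive x 1 f (df x),
  continuous df &
  forall x y z, x < y -> y < z ->
    `|(z - y) * df x + (y - x) * df z - (z - x) * df y|
      <= L / 2 * ((z - x) * (y - x) * (z - y))].

Lemma is_derive_poly_sub a b c d f df x : is_derive x 1 f (df x) ->
  is_derive x 1 (fun x => a + b * x + c * x ^+ 2 + d * x ^+ 3 - f x)
    (b + 2 * c * x + 3 * d * x ^+ 2 - df x).
Proof.
move=> fx; have := fx.
rewrite (_ : (fun x => _) = cst a + b \*: @id R + c \*: (@id R ^+ 2) +
  d \*: (@id R ^+ 3) - f); last first.
  by apply/funext => z.
move=> _; apply: is_derive_eq; rewrite /GRing.scale/= /GRing.scale/=.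
rewrite /=; ring.
Qed.

Lemma is_derive_oppr_comp f df x : (forall x, is_derive x 1 f (df x)) ->
  is_derive x 1 (fun x => f (- x)) (- df (- x)).
Proof.
move=> fdf; rewrite -mulrN1; apply: (is_derive1_comp (g := -%R)).

Qed.

Lemma cubic_smooth_oppr L f df : cubic_smooth L f df ->
  cubic_smooth L (fun x => f (- x)) (fun x => - df (- x)).
Proof.
move=> [fdf cdf K]; split.
- by move=> x; exact: is_derive_oppr_comp.
- by move=> x; apply: continuousN; apply: continuous_comp;
  [exact: continuousN|exact: cdf].
- move=> x y z xy yz.
  have := K (- z) (- y) (- x); rewrite !ltrN2 => /(_ yz xy).
  rewrite -normrN; set A := `|_|; set B := `|_|; move=> H.
  have -> : B = A by congr `|_|; ring.
  by apply: le_trans H _; lra.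
Qed.

(** The second divided difference of [3 d x ^ 2] is the constant [3 d >= L / 2], which outweighs
    that of [df]. *)
Lemma convex_from_poly_sub a b c d L f df : cubic_smooth L f df -> L / 6 <= d ->
  convex_from a (fun x => b + 2 * c * x + 3 * d * x ^+ 2 - df x).
Proof.
move=> [_ _ K] Ld x y z _ xy yz.
have := K x y z xy yz; rewrite ler_norml => /andP[_ H].
rewrite -subr_ge0.
have h0 : 0 <= (z - x) * (y - x) * (z - y) by rewrite !mulr_ge0//; lra.
suff : 0 <= (3 * d - L / 2) * ((z - x) * (y - x) * (z - y)) by move: H; nra.
by apply: mulr_ge0 => //; lra.
Qed.

End touching.

(** * Majorants touching at the atoms of a two-point law *)

Section two_point.
Context {R : realType}.
Implicit Types (f df : R -> R) (a b c d u v w x y z L m : R).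

(* The expectation of [f] under the standardized law with atoms [u] and [- v],
   where [u * v = 1]. *)
Definition two_point_mean u v f := (v * f u + u * f (- v)) / (u + v).

(* Vanishes iff some quadratic polynomial agrees with [f] to first order at
   both atoms. *)
Definition hermite_defect u v f df :=
  (u + v) * (df u + df (- v)) / 2 - f u + f (- v).

(** The factor of [d] in the last hypothesis is the defect of [|x|^3], so [f - d |x|^3] has defect 0
    and some quadratic agrees with it to first order at both atoms. The quadratic has expectation
    [a + c], the two-point law being standardized. *)
Lemma quadratic_majorant L f df u v d : 0 < u -> 0 < v -> u * v = 1 ->
  cubic_smooth L f df -> L / 6 <= d ->
  hermite_defect u v f df = d * ((u - v) * (u ^+ 2 + 4 * (u * v) + v ^+ 2) / 2) ->
  exists a b c, (forall x, f x <= a + b * x + c * x ^+ 2 + d * `|x| ^+ 3) /\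
    a + c + d * ((u ^+ 2 + v ^+ 2) / (u + v)) = two_point_mean u v f.
Proof.
move=> u0 v0 uv K Ld D.
have uv0 : u + v != 0 by rewrite gt_eqF// addr_gt0.
have [fdf _ _] := K.
(* The quadratic has an affine derivative, which must match that of [f - d |x|^3] at [u] and [- v];
   its slope is therefore [2 * k]. *)
pose k := ((df u - 3 * d * u ^+ 2) - (df (- v) + 3 * d * v ^+ 2)) / (2 * (u + v)).
have kE : 2 * k * (u + v) = (df u - 3 * d * u ^+ 2) - (df (- v) + 3 * d * v ^+ 2).
  by rewrite /k; field.
pose c := k.
pose b := (df u - 3 * d * u ^+ 2) - 2 * k * u.
pose a := (f u - d * u ^+ 3) - b * u - c * u ^+ 2.
have p1 : a + b * u + c * u ^+ 2 + d * u ^+ 3 - f u = 0 by rewrite /a; ring.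
have p1' : b + 2 * c * u + 3 * d * u ^+ 2 - df u = 0 by rewrite /b /c; ring.
have p2' : b - 2 * c * v - 3 * d * v ^+ 2 - df (- v) = 0.
  by move: kE; rewrite /b /c; lra.
(* Equality of values at [- v] is the one contact condition not built into [a], [b], [c]; the defect
   hypothesis supplies it. *)
have p2 : a - b * v + c * v ^+ 2 + d * v ^+ 3 - f (- v) = 0.
  have -> : f (- v) = d * ((u - v) * (u ^+ 2 + 4 * (u * v) + v ^+ 2) / 2)
     - (u + v) * (df u + df (- v)) / 2 + f u.
    by rewrite -D /hermite_defect; ring.
  have -> : df (- v) = b - 2 * c * v - 3 * d * v ^+ 2 by lra.
  have -> : df u = b + 2 * c * u + 3 * d * u ^+ 2 by lra.
  have -> : f u = a + b * u + c * u ^+ 2 + d * u ^+ 3 by lra.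
  by field.
exists a, b, c; split; last first.
  rewrite /two_point_mean.
  have -> : f u = a + b * u + c * u ^+ 2 + d * u ^+ 3 by lra.
  have -> : f (- v) = a - b * v + c * v ^+ 2 + d * v ^+ 3 by lra.
  have -> : v * (a + b * u + c * u ^+ 2 + d * u ^+ 3) +
     u * (a - b * v + c * v ^+ 2 + d * v ^+ 3) =
     (a + c * (u * v)) * (u + v) + d * (u * v) * (u ^+ 2 + v ^+ 2) by ring.
  by rewrite uv; field.
pose r1 x := a + b * x + c * x ^+ 2 + d * x ^+ 3 - f x.
pose r2 x := a + (- b) * x + c * x ^+ 2 + d * x ^+ 3 - f (- x).
have K2 := cubic_smooth_oppr K; have [f2 _ _] := K2.
have dr1 x : is_derive x 1 r1 _ := is_derive_poly_sub a b c d (fdf x).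
have dr2 x : is_derive x 1 r2 _ := 
  @is_derive_poly_sub R a (- b) c d (fun x => f (- x)) (fun x => - df (- x)) x (f2 x).
have c1 := @convex_from_poly_sub R 0 b c d L f df K Ld.
have c2 := @convex_from_poly_sub R 0 (- b) c d L _ _ K2 Ld.
have r1u : r1 u = 0 by rewrite /r1.
have r2v : r2 v = 0 by rewrite /r2; lra.
have dr1u : b + 2 * c * u + 3 * d * u ^+ 2 - df u = 0 by [].
have dr2v : - b + 2 * c * v + 3 * d * v ^+ 2 - (- df (- v)) = 0 by lra.
have r0 : r1 0 = r2 0 by rewrite /r1 /r2 oppr0; ring.
have [r1_ge0|r1_lt0] := lerP 0 (r1 0).
  move=> x; have [x0|x0] := lerP 0 x.
    have := touching_ge0 u0 dr1 c1 r1_ge0 r1u dr1u x0.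
    by rewrite /r1 (ger0_norm x0) subr_ge0.
  have x0' : 0 <= - x by lra.
  have r2_ge0 : 0 <= r2 0 by rewrite -r0.
  have := touching_ge0 v0 dr2 c2 r2_ge0 r2v dr2v x0'.
  rewrite /r2 (ltr0_norm x0) opprK; lra.
(* A negative difference at 0 would have positive slope in both directions away from 0; but [|x|^3]
   has derivative 0 there, so these slopes add up to 0. *)
have := touching_deriv_gt0 u0 dr1 c1 r1_lt0 r1u dr1u.
have r2_lt0 : r2 0 < 0 by rewrite -r0.
have := touching_deriv_gt0 v0 dr2 c2 r2_lt0 r2v dr2v.
rewrite oppr0; lra.
Qed.

(** A cubic with leading coefficient [L / 6] that meets [f] at [-1] and touches it at 1 lies above
    [f] on [[-1, +oo[], which contains both atoms since [v <= 1 <= u]. Its expectation exceeds its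
    symmetric two-point value by [L / 6] times the third moment [u - v]. *)
Lemma two_point_mean_le L f df u v : 0 < v -> 1 <= u -> u * v = 1 ->
  cubic_smooth L f df ->
  two_point_mean u v f <= (f 1 + f (-1)) / 2 + L / 6 * (u - v).
Proof.
move=> v0 u1 uv K; have [fdf _ _] := K.
have u0 : 0 < u by lra.
have v1 : v <= 1 by nra.
pose d := L / 6.
(* the quadratic interpolating [f - d x^3] at [-1] once and at [1] twice *)
pose c := (2 * df 1 - f 1 + f (-1) - 4 * d) / 4.
pose b := df 1 - 2 * c - 3 * d.
pose a := f 1 - b - c - d.
have dr x := is_derive_poly_sub a b c d (fdf x).
have cv := @convex_from_poly_sub R (-1) b c d L f df K (lexx d).
have p1 : 0 <= a + b * (-1) + c * (-1) ^+ 2 + d * (-1) ^+ 3 - f (-1).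
  by rewrite /a /b /c le_eqVlt; apply/orP; left; apply/eqP; field.
have p2 : a + b * 1 + c * 1 ^+ 2 + d * 1 ^+ 3 - f 1 = 0.
  by rewrite /a; ring.
have p3 : b + 2 * c * 1 + 3 * d * 1 ^+ 2 - df 1 = 0 by rewrite /b; ring.
have pos x : -1 <= x -> f x <= a + b * x + c * x ^+ 2 + d * x ^+ 3.
  move=> x1; rewrite -subr_ge0.
  by apply: (touching_ge0 _ dr cv p1 p2 p3 x1); lra.
have -> : (f 1 + f (-1)) / 2 = a + c by rewrite /a /b /c; field.
rewrite /two_point_mean ler_pdivrMr; last by lra.
have h1 : v * f u <= v * (a + b * u + c * u ^+ 2 + d * u ^+ 3).
  by apply: ler_wpM2l; [exact: ltW|apply: pos; lra].
have h2 : u * f (- v) <= u * (a + b * (- v) + c * (- v) ^+ 2 + d * (- v) ^+ 3).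
  by apply: ler_wpM2l; [exact: ltW|apply: pos; lra].
apply: (le_trans (lerD h1 h2)).
rewrite -/d le_eqVlt; apply/orP; left; apply/eqP.
have -> : v * (a + b * u + c * u ^+ 2 + d * u ^+ 3) +
  u * (a + b * - v + c * (- v) ^+ 2 + d * (- v) ^+ 3) =
  (a + c * (u * v) + d * (u * v) * (u - v)) * (u + v) by ring.
by rewrite uv; ring.
Qed.

End two_point.

(** * Two-point laws parametrized by their third moment *)

Section atoms.
Context {R : realType}.
Implicit Types (f df : R -> R) (w x L a b c d : R).

(* [atom w] and [- atom (- w)] are the atoms of the standardized two-point law
   with third moment [w]. *)
Definition atom w := (Num.sqrt (w ^+ 2 + 4) + w) / 2.

(** The third absolute moment of that law; on [w >= 0] its inverse function is [B]. *)
Definition two_point_rho w := (w ^+ 2 + 2) / Num.sqrt (w ^+ 2 + 4).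

Lemma sqrtD4_gt w : w < Num.sqrt (w ^+ 2 + 4).
Proof.
have [w0|w0] := ltP w 0; first exact: lt_le_trans w0 (sqrtr_ge0 _).
by rewrite -[ltLHS](@ger0_norm _ w)// -sqrtr_sqr ltr_sqrt; have := sqr_ge0 w; lra.
Qed.

Lemma atomD w : atom w + atom (- w) = Num.sqrt (w ^+ 2 + 4).
Proof. by rewrite /atom sqrrN; lra. Qed.

Lemma atomB w : atom w - atom (- w) = w.
Proof. by rewrite /atom sqrrN; lra. Qed.

Lemma atom_gt0 w : 0 < atom w.
Proof. by rewrite /atom; have := sqrtD4_gt (- w); rewrite sqrrN; lra. Qed.

Lemma atomM w : atom w * atom (- w) = 1.
Proof.
have := @sqr_sqrtr R (w ^+ 2 + 4); rewrite addr_ge0 ?sqr_ge0// => /(_ isT).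
by rewrite /atom sqrrN; set s := Num.sqrt _ => sE; lra.
Qed.

Lemma two_point_rhoE w :
  two_point_rho w = (atom w ^+ 2 + atom (- w) ^+ 2) / (atom w + atom (- w)).
Proof.
rewrite /two_point_rho -atomD; congr (_ / _).
by have := atomM w; have := atomB w; set u := atom w; set v := atom (- w) => <-; lra.
Qed.

Lemma two_point_rhoN w : two_point_rho (- w) = two_point_rho w.
Proof. by rewrite /two_point_rho sqrrN. Qed.

(** With atoms [u] and [- v], the difference is [2 v ^ 2 / (u + v)]; as [w] grows, [v] decreases and
    [u + v] increases. *)
Lemma two_point_rhoB w1 w2 : 0 <= w1 -> w1 <= w2 ->
  two_point_rho w2 - w2 <= two_point_rho w1 - w1.
Proof.
move=> w10 w12.
have w20 : 0 <= w2 by lra.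
have E w : two_point_rho w - w = 2 * atom (- w) ^+ 2 / (atom w + atom (- w)).
  have u0 := atom_gt0 w; have v0 := atom_gt0 (- w).
  have := atomB w; rewrite two_point_rhoE; set u := atom w in u0 *.
  set v := atom (- w) in v0 * => <-.
  by field; lra.
have s12 : Num.sqrt (w1 ^+ 2 + 4) <= Num.sqrt (w2 ^+ 2 + 4).
  by apply: ler_wsqrtr; nra.
have v1 := atom_gt0 (- w1); have v2 := atom_gt0 (- w2).
have v12 : atom (- w2) <= atom (- w1).
  have := atomM w1; have := atomM w2.
  have : atom w1 <= atom w2 by rewrite /atom; lra.
  have := atom_gt0 w1; nra.
rewrite !E ler_pM//.
- by rewrite mulr_ge0 ?sqr_ge0.
- by rewrite invr_ge0 addr_ge0// ltW// atom_gt0.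
- by rewrite ler_pM2l// ler_pXn2r// nnegrE ltW.
- by rewrite !atomD lef_pV2// posrE sqrtr_gt0; nra.
Qed.

Lemma atom_ge1 w : 0 <= w -> 1 <= atom w.
Proof. by move=> w0; have := atomM w; have := atomB w; have := atom_gt0 (- w); nra. Qed.

Lemma two_point_mean_oppr f u v :
  two_point_mean u v (fun x => f (- x)) = two_point_mean v u f.
Proof. by rewrite /two_point_mean opprK addrC [u + v]addrC. Qed.

(** For [w < 0] the negative atom has the larger modulus, and the bound is that of the reflected
    function. *)
Lemma atom_mean_le L f df w : cubic_smooth L f df ->
  two_point_mean (atom w) (atom (- w)) f <= (f 1 + f (-1)) / 2 + L / 6 * `|w|.
Proof.
move=> K; have [w0|w0] := lerP 0 w.
  have := two_point_mean_le (atom_gt0 _) (atom_ge1 w0) (atomM w) K.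
  by rewrite atomB (ger0_norm w0).
have w0' : 0 <= - w by lra.
have M : atom (- w) * atom w = 1 by rewrite mulrC atomM.
have := two_point_mean_le (atom_gt0 _) (atom_ge1 w0') M (cubic_smooth_oppr K).
have -> : atom (- w) - atom w = - w by have := atomB w; lra.
by rewrite two_point_mean_oppr (ltr0_norm w0) opprK [f (-1) + _]addrC.
Qed.

Lemma continuous_atom : continuous atom.
Proof.
move=> x; apply: cvgM; last exact: cvg_cst.
apply: cvgD; last exact: cvg_id.
apply: (@continuous_comp _ _ _ (fun w => w ^+ 2 + 4) Num.sqrt);
  last exact: sqrt_continuous.
apply: cvgD; [exact: exprn_continuous|exact: cvg_cst].
Qed.

Lemma cubic_majorant L f df w : 0 <= L -> 0 < w -> cubic_smooth L f df ->
  exists a b c d, [/\ 0 <= d, forall x, f x <= a + b * x + c * x ^+ 2 + d * `|x| ^+ 3 &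
    a + c + d * two_point_rho w <= (f 1 + f (-1)) / 2 + L / 6 * w].
Proof.
move=> L0 w0 K.
(* The defect of [|x|^3] at the atoms for [w]. *)
pose D3 w := (atom w - atom (- w)) *
  (atom w ^+ 2 + 4 * (atom w * atom (- w)) + atom (- w) ^+ 2) / 2.
pose phi w := hermite_defect (atom w) (atom (- w)) f df - L / 6 * D3 w.
have D3N t : D3 (- t) = - D3 t by rewrite /D3 opprK; lra.
have D3pos : 0 < D3 w.
  rewrite /D3 atomB divr_gt0// mulr_gt0//.
  by rewrite atomM; have := sqr_ge0 (atom w); have := sqr_ge0 (atom (- w)); lra.
(* The laws with third moments [w] and [- w] both have the prescribed third absolute moment; for
   them [d] is the quotient of the two defects. *)
have extreme t : `|t| = w -> D3 t != 0 ->
    L / 6 <= hermite_defect (atom t) (atom (- t)) f df / D3 t ->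
    exists a b c d, [/\ 0 <= d, forall x, f x <= a + b * x + c * x ^+ 2 +
      d * `|x| ^+ 3 &
      a + c + d * two_point_rho w <= (f 1 + f (-1)) / 2 + L / 6 * w].
  move=> tw D30 Ld; set d := (X in _ <= X) in Ld.
  have [|a [b [c [fle E]]]] :=
    quadratic_majorant (atom_gt0 t) (atom_gt0 (- t)) (atomM t) K Ld.
    by rewrite /d divfK.
  exists a, b, c, d; split; [by apply: le_trans Ld; apply: divr_ge0|exact: fle|].
  have -> : two_point_rho w = two_point_rho t.
    by rewrite -tw; case: (ler0P t) => _ //; rewrite two_point_rhoN.
  by rewrite two_point_rhoE E -tw; exact: atom_mean_le K.
have [phiw|phiw] := lerP 0 (phi w).
  apply: (extreme w); rewrite ?gtr0_norm ?gt_eqF//.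
  by rewrite ler_pdivlMr//; move: phiw; rewrite /phi; lra.
(* As [D3 (- w)] is negative, dividing by it reverses the condition on [phi]. *)
have [phiNw|phiNw] := lerP (phi (- w)) 0.
  apply: (extreme (- w)); rewrite ?normrN ?gtr0_norm ?D3N ?oppr_eq0 ?gt_eqF//.
  rewrite invrN mulrN -mulNr ler_pdivlMr//.
  by move: phiNw; rewrite /phi D3N; lra.
have cN : continuous (fun t => atom (- t)).
  by move=> t; apply: continuous_comp; [exact: continuousN|exact: continuous_atom].
have [fdf cdf _] := K.
have cf : continuous f.
  by move=> x; apply/differentiable_continuous/derivable1_diffP; case: (fdf x).
have c1 : continuous (fun t => f (atom t)).
  by move=> t; apply: continuous_comp; [exact: continuous_atom|exact: cf].
have c2 : continuous (fun t => df (atom t)).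
  by move=> t; apply: continuous_comp; [exact: continuous_atom|exact: cdf].
have cNN : continuous (fun t => - atom (- t)).
  by move=> t; apply: cvgN; exact: cN.
have c3 : continuous (fun t => f (- atom (- t))).
  by move=> t; apply: (@continuous_comp _ _ _ (fun t => - atom (- t)) f);
    [exact: cNN|exact: cf].
have c4 : continuous (fun t => df (- atom (- t))).
  by move=> t; apply: (@continuous_comp _ _ _ (fun t => - atom (- t)) df);
    [exact: cNN|exact: cdf].
have cphi : continuous phi.
  suff gen (p q g1 g2 g3 g4 : R -> R) : continuous p -> continuous q ->
      continuous g1 -> continuous g2 -> continuous g3 -> continuous g4 ->
      continuous (fun t => (p t + q t) * (g1 t + g2 t) / 2 - g3 t + g4 t -
        L / 6 * ((p t - q t) * (p t ^+ 2 + 4 * (p t * q t) + q t ^+ 2) / 2)).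
    exact: (gen _ _ _ _ _ _ continuous_atom cN c2 c4 c1 c3).
  move=> cp cq cg1 cg2 cg3 cg4 t.
  apply: cvgB; first (apply: cvgD; last exact: cg4).
    apply: cvgB; last exact: cg3.
    apply: cvgM; last exact: cvg_cst.
    by apply: cvgM; apply: cvgD; [exact: cp|exact: cq|exact: cg1|exact: cg2].
  apply: cvgM; first exact: cvg_cst.
  apply: cvgM; last exact: cvg_cst.
  apply: cvgM; first by apply: cvgB; [exact: cp|exact: cq].
  apply: cvgD; last by apply: cvgM; exact: cq.
  apply: cvgD; first by apply: cvgM; exact: cp.
  apply: cvgM; first exact: cvg_cst.
  by apply: cvgM; [exact: cp|exact: cq].
have [||t] := @IVT R phi (- w) w 0 _ (continuous_subspaceT cphi).
- lra.
- by rewrite ge_min le_max !(ltW phiw) (ltW phiNw) orbT.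
rewrite in_itv/= => /andP[wt tw] phit.
have tw' : `|t| <= w by rewrite ler_norml; lra.
have [|a [b [c [fle E]]]] :=
  quadratic_majorant (atom_gt0 t) (atom_gt0 (- t)) (atomM t) K (lexx (L / 6)).
  by move: phit; rewrite /phi /D3; lra.
exists a, b, c, (L / 6); split; [by apply: divr_ge0|exact: fle|].
have Et : two_point_rho `|t| = two_point_rho t.
  by case: (ler0P t) => _ //; rewrite two_point_rhoN.
(* The law found has third moment [t] with [|t| <= w]. Passing to [w] raises the third absolute
   moment by at most [w - |t|], exactly the slack in the bound. *)
have := atom_mean_le t K; rewrite -E -two_point_rhoE -Et.
have := two_point_rhoB (normr_ge0 t) tw'.
by nra.
Qed.

(** The radicand of [B rho] is [t ^ 2 - 4], with [t] the positive root of [t ^ 2 - rho t - 2]. Thus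
    [B rho < w] puts [s = sqrt (w ^ 2 + 4)] beyond this root, and [s ^ 2 - 2 >= rho s]. *)
Lemma B_le rho w : 1 <= rho -> B rho < w -> rho <= two_point_rho w.
Proof.
move=> rho1; rewrite /B.
set r := Num.sqrt (rho ^+ 2 + 8).
set X := _ - 2 => Bw.
have w0 : 0 < w := le_lt_trans (sqrtr_ge0 _) Bw.
have Xw : X < w ^+ 2.
  by move: Bw; rewrite -{1}(ger0_norm (ltW w0)) -sqrtr_sqr ltr_sqrt ?exprn_gt0.
have r0 : 0 <= r by apply: sqrtr_ge0.
have rE : r ^+ 2 = rho ^+ 2 + 8 by rewrite sqr_sqrtr; nra.
pose s := Num.sqrt (w ^+ 2 + 4).
have s0 : 0 < s by rewrite sqrtr_gt0; nra.
have sE : s ^+ 2 = w ^+ 2 + 4 by rewrite sqr_sqrtr; nra.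
pose t := (rho + r) / 2.
have tE : t ^+ 2 = X + 4 by rewrite /t /X; lra.
have t0 : 0 <= t by rewrite /t; lra.
have ts : t < s.
  have : t ^+ 2 < s ^+ 2 by rewrite tE sE ltrD2r; exact: Xw.
  by rewrite ltr_pXn2r // nnegrE ?(ltW s0).
rewrite /two_point_rho -/s ler_pdivlMr//.
have -> : w ^+ 2 + 2 = s ^+ 2 - 2 by lra.
have : t ^+ 2 - 2 = rho * t by rewrite /t; lra.
have : rho <= t by rewrite /t; nra.
nra.
Qed.

End atoms.

(** * Laws with finite third absolute moment *)

Section cubic_growth.
Context {R : realType}.
Implicit Types (P Q : law R) (g h : R -> R) (a b c x y : R).

(** A common class for all scalar integrands: stable under the operations below and integrable under
    every law with finite third absolute moment. *)
Definition cubic_growth g :=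
  continuous g /\ exists2 C, 0 <= C & forall x, `|g x| <= C * (1 + `|x| ^+ 3).

Lemma cubic_growth_cst c : cubic_growth (fun=> c).
Proof.
split; first exact: cst_continuous.
exists `|c| => // x; rewrite ler_peMr// lerDl; exact: exprn_ge0.
Qed.

Lemma cubic_growth_norm3 : cubic_growth (fun x => `|x| ^+ 3).
Proof.
split; last by exists 1 => // x; rewrite mul1r normrX normr_id lerDr.
have cn : continuous (fun x : R => `|x|) by exact: norm_continuous.
by move=> x; apply: cvgM; [exact: cn|apply: cvgM; exact: cn].
Qed.

Lemma cubic_growth_expr n : (n <= 3)%N -> cubic_growth (fun x => x ^+ n).
Proof.
move=> n3; split; first exact: exprn_continuous.
exists 1 => // x; rewrite mul1r normrX.
have [x1|x1] := lerP `|x| 1.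
  by apply: (@le_trans _ _ 1); [exact: exprn_ile1|rewrite lerDl exprn_ge0].
apply: (@le_trans _ _ (`|x| ^+ 3)); last by rewrite lerDr.
by apply: ler_weXn2l => //; exact: ltW.
Qed.

Lemma cubic_growthD g h : cubic_growth g -> cubic_growth h ->
  cubic_growth (fun x => g x + h x).
Proof.
move=> [cg [C C0 gC]] [ch [D D0 hD]]; split.
  by move=> x; apply: cvgD; [exact: cg|exact: ch].
exists (C + D) => [|x]; first exact: addr_ge0.
by rewrite mulrDl; apply: le_trans (ler_normD _ _) (lerD _ _).
Qed.

Lemma cubic_growthZ a g : cubic_growth g -> cubic_growth (fun x => a * g x).
Proof.
move=> [cg [C C0 gC]]; split.
  by move=> x; apply: cvgM; [exact: cvg_cst|exact: cg].
exists (`|a| * C) => [|x]; first exact: mulr_ge0.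
by rewrite normrM -mulrA ler_wpM2l.
Qed.

Lemma norm3D x y : `|x + y| ^+ 3 <= 4 * (`|x| ^+ 3 + `|y| ^+ 3).
Proof.
apply: (@le_trans _ _ ((`|x| + `|y|) ^+ 3)).
  by rewrite ler_pXn2r ?nnegrE// ?addr_ge0// ler_normD.
have := normr_ge0 x; have := normr_ge0 y; set p := `|x|; set q := `|y| => q0 p0.
rewrite -subr_ge0.
have -> : 4 * (p ^+ 3 + q ^+ 3) - (p + q) ^+ 3 = 3 * (p + q) * (p - q) ^+ 2 by ring.
by rewrite mulr_ge0 ?sqr_ge0// mulr_ge0// addr_ge0.
Qed.

Lemma cubic_growth_shift c g : cubic_growth g -> cubic_growth (fun x => g (x + c)).
Proof.
move=> [cg [C C0 gC]]; split.
  move=> x; apply: (@continuous_comp _ _ _ (fun y => y + c) g); last exact: cg.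
  by apply: cvgD; [exact: cvg_id|exact: cvg_cst].
exists (C * (4 + 4 * `|c| ^+ 3)) => [|x].
  by rewrite mulr_ge0// addr_ge0// mulr_ge0// exprn_ge0.
apply: le_trans (gC _) _; rewrite -mulrA ler_wpM2l//.
have := norm3D x c.
have := exprn_ge0 3 (normr_ge0 x); have := exprn_ge0 3 (normr_ge0 c).
set p := `|x| ^+ 3; set q := `|c| ^+ 3; set r := `|x + c| ^+ 3 => p0 q0 H.
have : 0 <= p * q by exact: mulr_ge0.
nra.
Qed.

Lemma cubic_growth_scale s g : cubic_growth g -> cubic_growth (fun x => g (s * x)).
Proof.
move=> [cg [C C0 gC]]; split.
  move=> x; apply: (@continuous_comp _ _ _ (fun y => s * y) g); last exact: cg.
  by apply: cvgM; [exact: cvg_cst|exact: cvg_id].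
exists (C * (1 + `|s| ^+ 3)) => [|x].
  by rewrite mulr_ge0// addr_ge0// exprn_ge0.
apply: le_trans (gC _) _; rewrite -mulrA ler_wpM2l//.
rewrite normrM exprMn.
have := exprn_ge0 3 (normr_ge0 x); have := exprn_ge0 3 (normr_ge0 s).
set p := `|x| ^+ 3; set q := `|s| ^+ 3 => p0 q0.
have : 0 <= p * q by exact: mulr_ge0.
nra.
Qed.

Lemma cubic_growth_affine_norm3 m s : cubic_growth (fun x => `|(x - m) / s| ^+ 3).
Proof.
apply: (@cubic_growth_shift (- m) (fun x => `|x / s| ^+ 3)).
rewrite (_ : (fun x => _) = (fun x => `|s^-1 * x| ^+ 3)); last first.
  by apply/funext => x; rewrite mulrC.
exact: (@cubic_growth_scale s^-1 (fun x => `|x| ^+ 3) cubic_growth_norm3).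
Qed.

Lemma cubic_growth_measurable g : cubic_growth g ->
  measurable_fun [set: measurableTypeR R] (g : measurableTypeR R -> R).
Proof. by move=> [cg _]; exact: continuous_measurable_fun. Qed.

Lemma expectation_cst_law P c : \int[P]_x c = c.
Proof.
rewrite Rintegral_cst// (_ : fine _ = 1) ?mulr1//.
exact: (congr1 fine (probability_setT P)).
Qed.

Definition finite_moment3 P := (\int[P]_x (`|x| ^+ 3)%:E < +oo)%E.

Lemma integrable_norm3 P : finite_moment3 P ->
  P.-integrable setT (EFin \o (fun x => `|x| ^+ 3)).
Proof.
move=> P3; apply/integrableP; split.
  apply/measurable_EFinP.
  by apply: cubic_growth_measurable; exact: cubic_growth_norm3.
by under eq_integral do rewrite /= normrX normr_id.
Qed.

Lemma integrable_cubic_growth P g : finite_moment3 P -> cubic_growth g ->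
  P.-integrable setT (EFin \o g).
Proof.
move=> P3 gg; have [_ [C C0 gC]] := gg.
have ig : P.-integrable setT (EFin \o (fun x => C * (1 + `|x| ^+ 3))).
  have i1 : P.-integrable setT (EFin \o cst (1 : R)).
    exact: finite_measure_integrable_cst.
  exact: (integrableZl measurableT C (integrableD measurableT i1 (integrable_norm3
    P3))).
apply: le_integrable ig => //.
  by apply/measurable_EFinP; exact: cubic_growth_measurable.
move=> x _ /=; rewrite lee_fin; apply: le_trans (gC x) _; exact: ler_norm.
Qed.

End cubic_growth.

(** * Fubini for convolutions *)

Section convolution_integral.
Context {R : realType}.
Implicit Types (P Q : law R) (g h : R -> R) (a b c x y : R).

Let measurable_sum g : cubic_growth g ->
  measurable_fun [set: measurableTypeR R * measurableTypeR R]
    (EFin \o (fun z => g (addition z))).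
Proof.
move=> gg; apply/measurable_EFinP.
by apply: (measurableT_comp (cubic_growth_measurable gg)); exact: measurable_funPT.
Qed.

(** By [norm3D] the integrand is dominated by [G], a function of [x] plus a function of [y], whose
    iterated integral is finite; Tonelli then applies. *)
Let integrable_sum P Q g : finite_moment3 P -> finite_moment3 Q ->
  cubic_growth g ->
  (P \x Q)%E.-integrable setT (EFin \o (fun z => g (addition z))).
Proof.
move=> P3 Q3 gg; have [_ [C C0 gC]] := gg.
apply/integrable12ltyP; first exact: measurable_sum.
have i1 := integrable_norm3 P3; have i2 := integrable_norm3 Q3.
pose G (x y : R) := C * (1 + 4 * `|x| ^+ 3) + (C * 4) * `|y| ^+ 3.
have mG x : measurable_fun [set: measurableTypeR R] (G x : measurableTypeR R -> R).
  apply: cubic_growth_measurable; apply: cubic_growthD; first exact: cubic_growth_cst.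
  by apply: cubic_growthZ; exact: cubic_growth_norm3.
have GE x : (\int[Q]_y (G x y)%:E =
   (C * (1 + 4 * `|x| ^+ 3) + C * 4 * \int[Q]_y (`|y| ^+ 3))%:E)%E.
  have ic : Q.-integrable setT (EFin \o cst (C * (1 + 4 * `|x| ^+ 3))).
    exact: finite_measure_integrable_cst.
  have i2' := integrableZl measurableT (C * 4) i2.
  rewrite -[LHS]fineK; last exact: integrable_fin_num (integrableD measurableT ic i2').
  congr EFin; rewrite -[LHS]/(\int[Q]_y (G x y)) /G.
  by rewrite RintegralD// expectation_cst_law RintegralZl//.
apply: (@le_lt_trans _ _ (\int[P]_x \int[Q]_y (G x y)%:E)%E).
  apply: ge0_le_integral => //.
  - by move=> x _; exact: integral_ge0.
  - apply: (measurable_fun_fubini_tonelli_F (abse \o (EFin \o (fun z => g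
    (addition z))))).
      by apply: measurableT_comp => //; exact: measurable_sum.
    by move=> z; exact: abse_ge0.
  - rewrite (_ : (fun x => _) = EFin \o (fun x => C * (1 + 4 * `|x| ^+ 3) +
    C * 4 * \int[Q]_y (`|y| ^+ 3))); last first.
      by apply/funext => x; rewrite GE.
    apply/measurable_EFinP; apply: cubic_growth_measurable.
    apply: cubic_growthD; last exact: cubic_growth_cst.
    apply: cubic_growthZ; apply: cubic_growthD; first exact: cubic_growth_cst.
    by apply: cubic_growthZ; exact: cubic_growth_norm3.
  - move=> x _; apply: ge0_le_integral => //.
    + apply: measurableT_comp => //; apply/measurable_EFinP.
      rewrite (_ : (fun y => _) = (fun y => g (y + x))); last first.
        by apply/funext => y; rewrite /addition/= addrC.
      by apply: cubic_growth_measurable; exact: cubic_growth_shift.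
    + by apply/measurable_EFinP; exact: mG.
    + move=> y _; rewrite lee_fin; apply: le_trans (gC _) _.
      rewrite /G /addition/= -mulrA -mulrDr ler_wpM2l//.
      by have := norm3D x y; lra.
have : P.-integrable setT (EFin \o (fun x => C * (1 + 4 * `|x| ^+ 3) +
  C * 4 * \int[Q]_y (`|y| ^+ 3))).
  apply: integrable_cubic_growth => //.
  apply: cubic_growthD; last exact: cubic_growth_cst.
  apply: cubic_growthZ; apply: cubic_growthD; first exact: cubic_growth_cst.
  by apply: cubic_growthZ; exact: cubic_growth_norm3.
by move/integrable_lty => /(_ measurableT); under eq_integral do rewrite /= -GE.
Qed.

Lemma finite_moment3_convolution P Q : finite_moment3 P -> finite_moment3 Q ->
  finite_moment3 (convolution P Q).
Proof.
move=> P3 Q3; rewrite /finite_moment3 /convolution.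
have gg := @cubic_growth_norm3 R.
rewrite ge0_integral_distribution//; last first.
  by apply/measurable_EFinP; exact: cubic_growth_measurable.
exact: integrable_lty (integrable_sum P3 Q3 gg).
Qed.

Lemma convolution_integrable P Q g : finite_moment3 P -> finite_moment3 Q ->
  cubic_growth g -> P.-integrable setT (EFin \o (fun x => \int[Q]_y g (x + y))).
Proof.
move=> P3 Q3 gg; have := integrable_fubini_F (integrable_sum P3 Q3 gg).
congr (_.-integrable _ _); apply/funext => x /=.
rewrite /fubini_F fineK//; apply: integrable_fin_num => //.
rewrite (_ : (fun y => _) = EFin \o (fun y => g (y + x))); last first.
  by apply/funext => y /=; rewrite addrC.
by apply: integrable_cubic_growth => //; exact: cubic_growth_shift.
Qed.

Lemma convolution_integral P Q g : finite_moment3 P -> finite_moment3 Q ->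
  cubic_growth g ->
  \int[convolution P Q]_z g z = \int[P]_x \int[Q]_y g (x + y).
Proof.
move=> P3 Q3 gg; have ig := integrable_sum P3 Q3 gg.
rewrite /Rintegral /convolution integral_distribution//; last first.
  by apply/measurable_EFinP; exact: cubic_growth_measurable.
rewrite -(integral12_prod_meas1 ig); congr fine; apply: eq_integral => x _ /=.
rewrite /fubini_F fineK//; apply: integrable_fin_num => //.
rewrite (_ : (fun y => _) = EFin \o (fun y => g (y + x))); last first.
  by apply/funext => y /=; rewrite addrC.
by apply: integrable_cubic_growth => //; exact: cubic_growth_shift.
Qed.

(** The replacement argument acts on the inner integral, so each factor has to be brought there in
    turn. *)
Lemma convolution_integralC P Q g : finite_moment3 P -> finite_moment3 Q ->
  cubic_growth g ->
  \int[convolution P Q]_z g z = \int[Q]_y \int[P]_x g (x + y).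
Proof.
move=> P3 Q3 gg; have ig := integrable_sum P3 Q3 gg.
rewrite /Rintegral /convolution integral_distribution//; last first.
  by apply/measurable_EFinP; exact: cubic_growth_measurable.
rewrite -(integral21_prod_meas1 ig); congr fine; apply: eq_integral => y _ /=.
rewrite /fubini_G fineK//; apply: integrable_fin_num => //.
by apply: (@integrable_cubic_growth _ P (fun x => g (x + y))) => //;
  exact: cubic_growth_shift.
Qed.

End convolution_integral.

(** * Moments of convolutions and of one- and two-point laws *)

Section moments.
Context {R : realType}.
Implicit Types (P Q : law R) (f df g : R -> R) (a b c d x y m s L : R).

Local Notation var P := (fine 'V_P[fun x => x]).

Lemma meanE P : mean P = \int[P]_x x.
Proof. by rewrite /mean unlock. Qed.

Lemma varE P : var P = \int[P]_x (x - mean P) ^+ 2.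
Proof. by rewrite /variance unlock /mean unlock. Qed.

Lemma centred_moment3E P : centred_moment3 P = \int[P]_x (x - mean P) ^+ 3.
Proof. by rewrite /centred_moment3 unlock. Qed.

Lemma std_abs_moment3E P :
  std_abs_moment3 P = \int[P]_x (`|(x - mean P) / stddev P| ^+ 3).
Proof. by rewrite /std_abs_moment3 unlock. Qed.

Lemma P3_finite_moment3 P : P3 P -> finite_moment3 P.
Proof. by rewrite /P3 unlock => -[]. Qed.

Lemma var_ge0 P : 0 <= var P.
Proof. by rewrite varE; apply: Rintegral_ge0 => x _; exact: sqr_ge0. Qed.

Lemma sqr_stddev P : stddev P ^+ 2 = var P.
Proof. by rewrite /stddev sqr_sqrtr// var_ge0. Qed.

Lemma cubic_growth_poly m a b c d : cubic_growth (fun x =>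
  a + b * (x - m) + c * (x - m) ^+ 2 + d * (x - m) ^+ 3).
Proof.
apply: (@cubic_growth_shift R (- m) (fun x => a + b * x + c * x ^+ 2 + d * x ^+ 3)).
have h n : (n <= 3)%N -> cubic_growth (fun x : R => x ^+ n).
  by move=> ?; exact: cubic_growth_expr.
by apply: cubic_growthD; [apply: cubic_growthD; [apply: cubic_growthD;
  [exact: cubic_growth_cst|exact/cubic_growthZ/(h 1)]|exact/cubic_growthZ/(h 2)]
  |exact/cubic_growthZ/(h 3)].
Qed.

Lemma RintegralD_growth P f g : finite_moment3 P -> cubic_growth f -> cubic_growth g ->
  \int[P]_x (f x + g x) = \int[P]_x f x + \int[P]_x g x.
Proof. by move=> P3 cf cg; rewrite RintegralD//; exact: integrable_cubic_growth. Qed.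

Lemma RintegralZ_growth P a g : finite_moment3 P -> cubic_growth g ->
  \int[P]_x (a * g x) = a * \int[P]_x g x.
Proof. by move=> P3 cg; rewrite RintegralZl//; exact: integrable_cubic_growth. Qed.

(** Centring at the mean kills the linear term. Moments of convolutions are computed by writing the
    integrands in this shape, zero coefficients included. *)
Lemma Rintegral_poly P a b c d : finite_moment3 P ->
  \int[P]_x (a + b * (x - mean P) + c * (x - mean P) ^+ 2 + d * (x - mean P) ^+ 3)
    = a + c * var P + d * centred_moment3 P.
Proof.
move=> P3; set m := mean P.
have h n : (n <= 3)%N -> cubic_growth (fun x : R => (x - m) ^+ n).
  by move=> n3; apply: (@cubic_growth_shift R (- m) (fun x => x ^+ n));
    exact: cubic_growth_expr.
have c0 := cubic_growth_cst a.
have c1 : cubic_growth (fun x => b * (x - m)) by exact/cubic_growthZ/(h 1).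
have c2 : cubic_growth (fun x => c * (x - m) ^+ 2) by exact/cubic_growthZ/(h 2).
have c3 : cubic_growth (fun x => d * (x - m) ^+ 3) by exact/cubic_growthZ/(h 3).
rewrite RintegralD_growth//; last by do 2 apply: cubic_growthD => //.
rewrite RintegralD_growth//; last by apply: cubic_growthD.
rewrite RintegralD_growth// expectation_cst_law.
rewrite (RintegralZ_growth b P3 (h 1%N isT)) (RintegralZ_growth c P3 (h 2%N isT)).
rewrite (RintegralZ_growth d P3 (h 3%N isT)) varE centred_moment3E -/m.
have -> : \int[P]_x (x - m) = 0.
  rewrite RintegralD_growth ?expectation_cst_law -?meanE ?subrr//.
    exact: (@cubic_growth_expr R 1).
  exact: cubic_growth_cst.
by rewrite mulr0 addr0.
Qed.

Lemma mean_convolution P Q : finite_moment3 P -> finite_moment3 Q ->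
  mean (convolution P Q) = mean P + mean Q.
Proof.
move=> P3 Q3; rewrite [LHS]meanE.
rewrite convolution_integral//; last exact: (@cubic_growth_expr R 1).
transitivity (\int[P]_x (mean P + mean Q + 1 * (x - mean P) + 0 * (x - mean P) ^+
  2 + 0 * (x - mean P) ^+ 3)); last first.
  by rewrite Rintegral_poly// !mul0r !addr0.
apply: eq_Rintegral => x _.
transitivity (\int[Q]_y (x + mean Q + 1 * (y - mean Q) + 0 * (y - mean Q) ^+ 2 +
  0 * (y - mean Q) ^+ 3)).
  by apply: eq_Rintegral => y _; ring.
by rewrite Rintegral_poly//; ring.
Qed.

Lemma var_convolution P Q : finite_moment3 P -> finite_moment3 Q ->
  var (convolution P Q) = var P + var Q.
Proof.
move=> P3 Q3; rewrite [LHS]varE mean_convolution//.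
rewrite convolution_integral//; last first.
  by apply: (@cubic_growth_shift R _ (fun x => x ^+ 2)); exact: cubic_growth_expr.
transitivity (\int[P]_x (var Q + 0 * (x - mean P) + 1 * (x - mean P) ^+ 2 +
  0 * (x - mean P) ^+ 3)); last first.
  by rewrite Rintegral_poly//; ring.
apply: eq_Rintegral => x _.
transitivity (\int[Q]_y ((x - mean P) ^+ 2 + (2 * (x - mean P)) * (y - mean Q) +
  1 * (y - mean Q) ^+ 2 + 0 * (y - mean Q) ^+ 3)).
  by apply: eq_Rintegral => y _; ring.
by rewrite Rintegral_poly//; ring.
Qed.

Lemma centred_moment3_convolution P Q : finite_moment3 P -> finite_moment3 Q ->
  centred_moment3 (convolution P Q) = centred_moment3 P + centred_moment3 Q.
Proof.
move=> P3 Q3; rewrite [LHS]centred_moment3E mean_convolution//.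
rewrite convolution_integral//; last first.
  by apply: (@cubic_growth_shift R _ (fun x => x ^+ 3)); exact: cubic_growth_expr.
transitivity (\int[P]_x (centred_moment3 Q + (3 * var Q) * (x - mean P) +
  0 * (x - mean P) ^+ 2 + 1 * (x - mean P) ^+ 3)); last first.
  by rewrite Rintegral_poly//; ring.
apply: eq_Rintegral => x _.
transitivity (\int[Q]_y ((x - mean P) ^+ 3 + (3 * (x - mean P) ^+
  2) * (y - mean Q) + (3 * (x - mean P)) * (y - mean Q) ^+ 2 + 1 * (y - mean Q) ^+ 3)).
  by apply: eq_Rintegral => y _; ring.
by rewrite Rintegral_poly//; ring.
Qed.

Lemma ge0_two_point_integral P a b p (g : R -> \bar R) : 0 <= p <= 1 ->
  (forall A, measurable A ->
      P A = (p%:E * point_law a A + (1 - p)%:E * point_law b A)%E) ->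
  measurable_fun [set: measurableTypeR R] (g : measurableTypeR R -> _) ->
  (forall x, 0 <= g x)%E ->
  (\int[P]_x g x = p%:E * g a + (1 - p)%:E * g b)%E.
Proof.
move=> /andP[p0 p1] PE mg g0.
have q0 : 0 <= 1 - p by rewrite subr_ge0.
pose p' := NngNum p0; pose q' := NngNum q0.
rewrite (eq_measure_integral (measure_add (mscale p' (point_law a)) (mscale q'
  (point_law b)))); last first.
  move=> A mA _; apply: (etrans (PE A mA)); apply/esym.
  exact: (measure_addE (mscale p' (point_law a)) (mscale q' (point_law b))).
rewrite ge0_integral_measure_add//.
rewrite !ge0_integral_mscale//.
by rewrite !integral_dirac// !diracT !mul1e.
Qed.

Lemma two_point_integral P a b p g : 0 <= p <= 1 ->
  (forall A, measurable A ->
      P A = (p%:E * point_law a A + (1 - p)%:E * point_law b A)%E) ->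
  measurable_fun [set: measurableTypeR R] (g : measurableTypeR R -> R) ->
  \int[P]_x g x = p * g a + (1 - p) * g b.
Proof.
move=> p01 PE mg.
have mg' : measurable_fun [set: measurableTypeR R] (EFin \o g : measurableTypeR R -> _).
  exact/measurable_EFinP.
rewrite /Rintegral integralE.
rewrite (ge0_two_point_integral p01 PE); [|exact: measurable_funepos|by []].
rewrite (ge0_two_point_integral p01 PE); [|exact: measurable_funeneg|by []].
rewrite !funeposE !funenegE /= -!EFin_max -!EFinM -!EFinD /=.
(* Positive part as function plus negative part: after this rewriting the negative parts cancel by
   [ring]. *)
have E x : Num.max (g x) 0 = g x + Num.max (- g x) 0.
  by have [h|h] := lerP (g x) 0; [rewrite max_l|rewrite max_r]; lra.
by rewrite !E; ring.
Qed.

Lemma symmetric_lawE s A : measurable A -> symmetric_law s A =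
  ((2^-1)%:E * point_law (- s) A + (1 - 2^-1)%:E * point_law s A)%E.
Proof.
move=> mA; rewrite (_ : 1 - 2^-1 = 2^-1 :> R); last by lra.
rewrite -ge0_muleDr//.
congr (_ * _)%E.
exact: (measure_addE (point_law (- s)) (point_law s)).
Qed.

Lemma two_point_finite_moment3 P a b p : 0 <= p <= 1 ->
  (forall A, measurable A ->
      P A = (p%:E * point_law a A + (1 - p)%:E * point_law b A)%E) ->
  finite_moment3 P.
Proof.
move=> p01 PE; rewrite /finite_moment3 (ge0_two_point_integral p01 PE).
- by rewrite -!EFinM -EFinD ltry.
- by apply/measurable_EFinP; apply: cubic_growth_measurable; exact: cubic_growth_norm3.
- by move=> x; rewrite lee_fin exprn_ge0.
Qed.

Let half01 : 0 <= (2^-1 : R) <= 1. Proof. lra. Qed.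

Lemma symmetric_law_integral s g : cubic_growth g ->
  \int[symmetric_law s]_x g x = (g s + g (- s)) / 2.
Proof.
move=> gg; rewrite (two_point_integral half01 (symmetric_lawE s));
  last exact: cubic_growth_measurable.
lra.
Qed.

Lemma finite_moment3_symmetric_law s : finite_moment3 (symmetric_law s).
Proof. exact: two_point_finite_moment3 half01 (symmetric_lawE s). Qed.

Lemma mean_symmetric_law s : mean (symmetric_law s) = 0.
Proof. by rewrite meanE symmetric_law_integral ?subrr ?mul0r//;
  exact: (@cubic_growth_expr R 1). Qed.

Lemma var_symmetric_law s : var (symmetric_law s) = s ^+ 2.
Proof.
rewrite varE mean_symmetric_law symmetric_law_integral.
  by rewrite !subr0; lra.
by apply: (@cubic_growth_shift R _ (fun x => x ^+ 2)); exact: cubic_growth_expr.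
Qed.

Lemma centred_moment3_symmetric_law s : centred_moment3 (symmetric_law s) = 0.
Proof.
rewrite centred_moment3E mean_symmetric_law symmetric_law_integral.
  by rewrite !subr0; lra.
by apply: (@cubic_growth_shift R _ (fun x => x ^+ 3)); exact: cubic_growth_expr.
Qed.

Lemma point_law_integral a g : cubic_growth g -> \int[point_law a]_x g x = g a.
Proof.
move=> /cubic_growth_measurable gg; rewrite /Rintegral integral_dirac//.
  by rewrite diracT mul1e.
exact/measurable_EFinP.
Qed.

Lemma finite_moment3_point_law a : finite_moment3 (point_law a).
Proof.
rewrite /finite_moment3 integral_dirac//; first by rewrite diracT mul1e ltry.
by apply/measurable_EFinP; apply: cubic_growth_measurable; exact: cubic_growth_norm3.
Qed.

Lemma finite_moment3_convolutions n (P : 'I_n -> law R) :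
  (forall i, finite_moment3 (P i)) -> finite_moment3 (convolutions P).
Proof.
move=> P3; rewrite /convolutions; elim/big_ind: _ => // [|Q1 Q2 *].
  exact: finite_moment3_point_law.
exact: finite_moment3_convolution.
Qed.

Lemma mean_point_law a : mean (point_law a) = a.
Proof. by rewrite meanE point_law_integral//; exact: (@cubic_growth_expr R 1). Qed.

(** Meant for the mean, the variance and the centred third moment: these are the first three
    cumulants, hence additive under convolution. *)
Let additive_convolutions (T : law R -> R) n (P : 'I_n -> law R) :
  T (point_law 0) = 0 ->
  (forall P Q, finite_moment3 P -> finite_moment3 Q ->
     T (convolution P Q) = T P + T Q) ->
  (forall i, finite_moment3 (P i)) -> T (convolutions P) = \sum_(i < n) T (P i).
Proof.
move=> T0 TD; rewrite /convolutions; elim: n P => [|n IH] P P3.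
  by rewrite !big_ord0.
rewrite !big_ord_recl TD//; last exact: finite_moment3_convolutions.
by rewrite IH.
Qed.

Lemma mean_convolutions n (P : 'I_n -> law R) : (forall i, finite_moment3 (P i)) ->
  mean (convolutions P) = \sum_(i < n) mean (P i).
Proof.
by apply: additive_convolutions; [exact: mean_point_law|exact: mean_convolution].
Qed.

Lemma var_convolutions n (P : 'I_n -> law R) : (forall i, finite_moment3 (P i)) ->
  var (convolutions P) = \sum_(i < n) var (P i).
Proof.
apply: (@additive_convolutions (fun P => var P)); last exact: var_convolution.
rewrite varE point_law_integral ?mean_point_law ?subrr ?expr0n//.
by apply: (@cubic_growth_shift R _ (fun x => x ^+ 2)); exact: cubic_growth_expr.
Qed.

Lemma centred_moment3_convolutions n (P : 'I_n -> law R) :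
  (forall i, finite_moment3 (P i)) ->
  centred_moment3 (convolutions P) = \sum_(i < n) centred_moment3 (P i).
Proof.
apply: additive_convolutions; last exact: centred_moment3_convolution.
rewrite centred_moment3E point_law_integral ?mean_point_law ?subrr ?expr0n//.
by apply: (@cubic_growth_shift R _ (fun x => x ^+ 3)); exact: cubic_growth_expr.
Qed.

End moments.

(** * The Lindeberg argument *)

Section lindeberg.
Context {R : realType}.
Implicit Types (P Q : law R) (f df g dg : R -> R) (a b c d w x y z m s L rho : R).

Local Notation var P := (fine 'V_P[fun x => x]).

Lemma cubic_smooth_shift L f df c : cubic_smooth L f df ->
  cubic_smooth L (fun x => f (x + c)) (fun x => df (x + c)).
Proof.
move=> [fdf cdf K]; split.
- move=> x; rewrite -[df _]mulr1; apply: (is_derive1_comp (g := fun x => x + c)).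
  rewrite -[X in is_derive _ _ _ X]addr0.
  by apply: is_deriveD.
- move=> x; apply: (@continuous_comp _ _ _ (fun y => y + c) df); last exact: cdf.
  by apply: cvgD; [exact: cvg_id|exact: cvg_cst].
- move=> x y z xy yz.
  have := K (x + c) (y + c) (z + c); rewrite !ltrD2r => /(_ xy yz).
  have E p q : p + c - (q + c) = p - q by ring.
  by rewrite !E.
Qed.

(** [L] plays the part of a bound on the third derivative, hence the factor [s ^ 3]. *)
Lemma cubic_smooth_scale L f df s : 0 < s -> cubic_smooth L f df ->
  cubic_smooth (L * s ^+ 3) (fun x => f (s * x)) (fun x => s * df (s * x)).
Proof.
move=> s0 [fdf cdf K]; split.
- move=> x; rewrite [s * _]mulrC; apply: (is_derive1_comp (g := fun x => s * x)).
  rewrite -[X in is_derive _ _ _ X]mulr1.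
  by apply: is_deriveZ.
- move=> x; apply: cvgM; first exact: cvg_cst.
  apply: (@continuous_comp _ _ _ (fun y => s * y) df); last exact: cdf.
  by apply: cvgM; [exact: cvg_cst|exact: cvg_id].
- move=> x y z xy yz.
  have := K (s * x) (s * y) (s * z); rewrite !ltr_pM2l// => /(_ xy yz).
  rewrite -!mulrBr.
  set A := `|_|; set B := `|_|.
  have -> : B = A by congr `|_|; ring.
  by move/le_trans; apply; rewrite le_eqVlt; apply/orP; left; apply/eqP; ring.
Qed.

Lemma cubic_smoothN L f df : cubic_smooth L f df ->
  cubic_smooth L (fun x => - f x) (fun x => - df x).
Proof.
move=> [fdf cdf K]; split.
- by move=> x; apply: is_deriveN.
- by move=> x; apply: cvgN; exact: cdf.
- move=> x y z xy yz; apply: le_trans (K x y z xy yz).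
  rewrite -normrN; set A := `|_|; set B := `|_|.
  by have -> : A = B by congr `|_|; ring.
Qed.

(** Cubic majorants of [f] and of [- f] together bound [|f|]; the parameter 1 given to
    [cubic_majorant] is arbitrary. *)
Lemma cubic_smooth_growth L f df : 0 <= L -> cubic_smooth L f df -> cubic_growth f.
Proof.
move=> L0 K; have [fdf _ _] := K; split.
  by move=> x; apply/differentiable_continuous/derivable1_diffP; case: (fdf x).
have [a [b [c [d [d0 fle _]]]]] := cubic_majorant L0 ltr01 K.
have [a' [b' [c' [d' [d0' fle' _]]]]] := cubic_majorant L0 ltr01 (cubic_smoothN K).
have bnd p q r t x : p + q * x + r * x ^+ 2 + t * `|x| ^+ 3 <=
    (`|p| + `|q| + `|r| + `|t|) * (1 + `|x| ^+ 3).
  have x3 := exprn_ge0 3 (normr_ge0 x).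
  have x1 : `|x| <= 1 + `|x| ^+ 3.
    have [|h] := lerP `|x| 1; first by lra.
    have : `|x| <= `|x| ^+ 3 by rewrite -[leLHS]expr1 ler_weXn2l// ltW.
    lra.
  have x2 : `|x| ^+ 2 <= 1 + `|x| ^+ 3.
    have [h|h] := lerP `|x| 1; first by have := @exprn_ile1 _ 2 _ (normr_ge0 x) h; lra.
    have : `|x| ^+ 2 <= `|x| ^+ 3 by rewrite ler_weXn2l// ltW.
    lra.
  have h1 : p <= `|p| * (1 + `|x| ^+ 3).
    by apply: le_trans (ler_norm p) _; rewrite ler_peMr//; lra.
  have h2 : q * x <= `|q| * (1 + `|x| ^+ 3).
    by apply: le_trans (ler_norm _) _; rewrite normrM ler_wpM2l.
  have h3 : r * x ^+ 2 <= `|r| * (1 + `|x| ^+ 3).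
    by apply: le_trans (ler_norm _) _; rewrite normrM normrX ler_wpM2l.
  have h4 : t * `|x| ^+ 3 <= `|t| * (1 + `|x| ^+ 3).
    by apply: le_trans (ler_norm _) _; rewrite normrM normrX normr_id ler_wpM2l//; lra.
  lra.
exists (`|a| + `|b| + `|c| + `|d| + (`|a'| + `|b'| + `|c'| + `|d'|)).
  by rewrite !addr_ge0.
move=> x; have := le_trans (fle x) (bnd a b c d x).
have := le_trans (fle' x) (bnd a' b' c' d' x).
have x3 := exprn_ge0 3 (normr_ge0 x).
set S := `|a| + _ + _ + _; set S' := `|a'| + _ + _ + _.
have S0 : 0 <= S * (1 + `|x| ^+ 3) by rewrite mulr_ge0 ?addr_ge0.
have S0' : 0 <= S' * (1 + `|x| ^+ 3) by rewrite mulr_ge0 ?addr_ge0.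
rewrite ler_norml => h1 h2; apply/andP; split; lra.
Qed.

(** [stddev] passes through [fine], which sends [+oo] to 0; so the finiteness of the variance, a
    consequence of the third moment, enters as well. *)
Lemma stddev_gt0 P : P3 P -> 0 < stddev P.
Proof.
move=> P3P; have [_ V0] := P3P; rewrite /stddev sqrtr_gt0.
apply: fine_gt0; rewrite V0/=; move: V0 => _.
rewrite /variance unlock.
have P3 := P3_finite_moment3 P3P.
have gg : cubic_growth (fun x => (x - mean P) ^+ 2).
  by apply: (@cubic_growth_shift R _ (fun x => x ^+ 2)); exact: cubic_growth_expr.
have := integrable_lty measurableT (integrable_cubic_growth P3 gg).
by rewrite /mean unlock.
Qed.

(** Integrates [|y|^3 >= (3 y ^ 2 - 1) / 2], the tangent bound in [y ^ 2] at 1, over the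
    standardized variable [y]. *)
Lemma one_le_std_abs_moment3 P : P3 P -> 1 <= std_abs_moment3 P.
Proof.
move=> P3P; have P3 := P3_finite_moment3 P3P; have s0 := stddev_gt0 P3P.
rewrite std_abs_moment3E; set s := stddev P in s0 *; set m := mean P.
have g1 := cubic_growth_poly m (- 2^-1) 0 (3 / 2 * s ^- 2) 0.
have g2 : cubic_growth (fun x => `|(x - m) / s| ^+ 3).
  exact: cubic_growth_affine_norm3.
have := @le_Rintegral _ _ _ P setT _ _ measurableT (integrable_cubic_growth P3 g1)
  (integrable_cubic_growth P3 g2).
rewrite Rintegral_poly// -sqr_stddev -/s mul0r addr0 => /(_ _)/wrap[x _|].
  have -> : - 2^-1 + 0 * (x - m) + 3 / 2 * s ^- 2 * (x - m) ^+ 2 + 0 * (x - m) ^+ 3 =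
    - 2^-1 + 3 / 2 * `|(x - m) / s| ^+ 2.
    by rewrite real_normK ?num_real//; field; lra.
  have := normr_ge0 ((x - m) / s); set y := `|_| => y0.
  rewrite -subr_ge0.
  have -> : y ^+ 3 - (- 2^-1 + 3 / 2 * y ^+ 2) = (y - 1) ^+ 2 * (2 * y +
    1) / 2 by field.
  by rewrite divr_ge0// mulr_ge0 ?sqr_ge0//; lra.
have -> : - 2^-1 + 3 / 2 * s ^- 2 * s ^+ 2 = 1 :> R by field; lra.
by [].
Qed.

(** The majorant is taken for [g (s * x)], whose constant is [L s ^ 3], and integrated at
    [(x - m) / s]. *)
Lemma one_step P L g dg : P3 P -> 0 <= L -> cubic_smooth L g dg ->
  \int[P]_x g (x - mean P) <= \int[symmetric_law (stddev P)]_x g x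
    + L / 6 * (stddev P ^+ 3 * B (std_abs_moment3 P)).
Proof.
move=> P3P L0 K; have P3 := P3_finite_moment3 P3P; have s0 := stddev_gt0 P3P.
have rho1 := one_le_std_abs_moment3 P3P.
set s := stddev P in s0 *; set m := mean P; set rho := std_abs_moment3 P in rho1 *.
have gg := cubic_smooth_growth L0 K.
have Ls0 : 0 <= L * s ^+ 3 by rewrite mulr_ge0// exprn_ge0// ltW.
rewrite symmetric_law_integral//.
(* [B rho] is 0 when [rho = 1], whereas [cubic_majorant] asks for [w > 0]; hence the passage to the
   limit from above. *)
suff H w : B rho < w ->
    \int[P]_x g (x - m) <= (g s + g (- s)) / 2 + L * s ^+ 3 / 6 * w.
  apply/ler_addgt0Pr => e e0.
  (* The added 1 allows for [L = 0]. *)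
  have k0 : 0 < L * s ^+ 3 / 6 + 1 by lra.
  have := H (B rho + e / (L * s ^+ 3 / 6 + 1)); rewrite ltrDl divr_gt0// => /(_ isT).
  move/le_trans; apply.
  have : L * s ^+ 3 / 6 * (e / (L * s ^+ 3 / 6 + 1)) <= e.
    by rewrite mulrA ler_pdivrMr// mulrC ler_pM2l//; lra.
  lra.
move=> Bw.
have w0 : 0 < w := le_lt_trans (sqrtr_ge0 _) Bw.
have [a [b [c [d [d0 hle E]]]]] := cubic_majorant Ls0 w0 (cubic_smooth_scale s0 K).
have g1 := cubic_growth_poly m a (b / s) (c / s ^+ 2) 0.
have g2 : cubic_growth (fun x => `|(x - m) / s| ^+ 3).
  exact: cubic_growth_affine_norm3.
have g2d := cubic_growthZ d g2.
have gm : cubic_growth (fun x => g (x - m)) := cubic_growth_shift _ gg.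
have := @le_Rintegral _ _ _ P setT _ _ measurableT (integrable_cubic_growth P3 gm)
  (integrable_cubic_growth P3 (cubic_growthD g1 g2d)).
rewrite RintegralD_growth// Rintegral_poly// RintegralZ_growth// -sqr_stddev -/s.
rewrite -std_abs_moment3E -/rho => /(_ _)/wrap[x _|].
  apply: le_trans (_ : _ <= a + b * ((x - m) / s) + c * ((x - m) / s) ^+ 2 +
    d * `|(x - m) / s| ^+ 3) _; last first.
    rewrite lerD2r le_eqVlt; apply/orP; left; apply/eqP; field; lra.
  by have := hle ((x - m) / s); rewrite mulrCA divff ?mulr1//; lra.
move/le_trans; apply.
have := B_le rho1 Bw => /(ler_wpM2l d0) Hd.
move: E; rewrite mulr1 mulrN1 => E.
have -> : a + c / s ^+ 2 * s ^+ 2 + 0 * centred_moment3 P + d * rho = a + c + d * rho.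
  by field; lra.
by lra.
Qed.

(** Induction on [n], for all [g] at once: with the first variable fixed at [x], the hypothesis is
    applied to a translate of [g], which has the same [L]. *)
Lemma lindeberg n (P : 'I_n -> law R) L g dg : (forall i, P3 (P i)) -> 0 <= L ->
  cubic_smooth L g dg ->
  \int[convolutions P]_x g (x - \sum_(i < n) mean (P i)) <=
  \int[convolutions (fun i => symmetric_law (stddev (P i)))]_x g x +
  L / 6 * \sum_(i < n) stddev (P i) ^+ 3 * B (std_abs_moment3 (P i)).
Proof.
move=> + L0; elim: n P g dg => [|n IH] P g dg P3P K.
  rewrite /convolutions !big_ord0 mulr0 addr0.
  by rewrite !point_law_integral ?subr0//;
    [exact: cubic_smooth_growth K|apply: cubic_growth_shift;
      exact: cubic_smooth_growth K].
have gg := cubic_smooth_growth L0 K.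
rewrite /convolutions !big_ord_recl.
pose P' i := P (lift ord0 i).
pose S i := symmetric_law (stddev (P i)).
pose S' i := S (lift ord0 i).
rewrite -/(convolutions P') -/(convolutions S') -/(S ord0).
have P3' i : P3 (P' i) by exact: P3P.
have fP i : finite_moment3 (P i) by exact: P3_finite_moment3.
have fC : finite_moment3 (convolutions P').
  by apply: finite_moment3_convolutions => i; exact: fP.
have fS i : finite_moment3 (S i) by exact: finite_moment3_symmetric_law.
have fCS : finite_moment3 (convolutions S').
  by apply: finite_moment3_convolutions => i; exact: fS.
set m := mean (P ord0); set M := \sum_(i < n) _.
set b0 := _ ^+ 3 * B _; set b := \sum_(i < n) _.
have gsh c : cubic_growth (fun x => g (x + c)) by exact: cubic_growth_shift.
(* The hybrid: first summand unchanged, all others replaced. *)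
apply: (@le_trans _ _ (\int[P ord0]_x (\int[convolutions S']_y g (x + (y - m)) +
  L / 6 * b))).
  rewrite (convolution_integral (fP ord0) fC (gsh _)).
  apply: le_Rintegral => //.
  - exact: (@convolution_integrable _ _ _ (fun x => g (x - (m + M)))).
  - have := integrableD measurableT
      (@convolution_integrable _ _ _ (fun x => g (x - m)) (fP ord0) fCS (gsh _))
      (@finite_measure_integrable_cst _ _ R (P ord0) setT (L / 6 * b) measurableT).
    congr (_.-integrable _ _); apply/funext => x /=; congr (_ + _)%:E.
    by apply: eq_Rintegral => y _; rewrite addrA.
  - move=> x _.
    have := IH P' (fun y => g (y + (x - m))) (fun y => dg (y + (x - m))) P3'
      (cubic_smooth_shift (x - m) K).
    rewrite -/M -/b; congr (_ <= _ + _).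
      by apply: eq_Rintegral => y _; congr g; ring.
    by apply: eq_Rintegral => y _; congr g; ring.
have iS : (P ord0).-integrable setT (EFin \o (fun x => \int[convolutions S']_y g
  (x + (y - m)))).
  have := @convolution_integrable _ _ _ (fun x => g (x - m)) (fP ord0) fCS (gsh _).
  congr (_.-integrable _ _); apply/funext => x /=; congr (_)%:E.
  by apply: eq_Rintegral => y _; rewrite addrA.
rewrite RintegralD//; last exact: finite_measure_integrable_cst.
rewrite expectation_cst_law mulrDr addrA lerD2r.
(* Fubini moves the first summand inside, where [one_step] replaces it for each fixed [y]. *)
have -> : \int[P ord0]_x \int[convolutions S']_y g (x + (y - m)) =
    \int[convolutions S']_y \int[P ord0]_x g (x + y - m).
  rewrite -(convolution_integralC (fP ord0) fCS (gsh (- m))).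
  rewrite (convolution_integral (fP ord0) fCS (gsh (- m))).
  by apply: eq_Rintegral => x _; apply: eq_Rintegral => y _; rewrite addrA.
have iC (Q : law R) c : finite_moment3 Q -> (convolutions S').-integrable setT
    (EFin \o (fun y => \int[Q]_x g (x + y + c))).
  move=> fQ; have := @convolution_integrable _ _ _ (fun x => g (x + c)) fCS fQ (gsh _).
  congr (_.-integrable _ _); apply/funext => y /=; congr (_)%:E.
  by apply: eq_Rintegral => x _; rewrite [y + x]addrC.
have iC0 := iC _ 0 (fS ord0).
rewrite (convolution_integralC (fS ord0) fCS gg).
have -> : \int[convolutions S']_y \int[S ord0]_x g (x + y) =
    \int[convolutions S']_y \int[S ord0]_x g (x + y + 0).
  by apply: eq_Rintegral => y _; apply: eq_Rintegral => x _; rewrite addr0.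
rewrite -[leRHS](_ : \int[convolutions S']_y (\int[S ord0]_x g (x + y + 0) +
  L / 6 * b0) = _); last first.
  by rewrite RintegralD// ?expectation_cst_law//; exact: finite_measure_integrable_cst.
apply: le_Rintegral => //; first exact: iC.
  exact: (integrableD measurableT iC0
    (@finite_measure_integrable_cst _ _ R (convolutions S') setT (L / 6 * b0)
      measurableT)).
move=> y _; have := one_step (P3P ord0) L0 (cubic_smooth_shift y K).
rewrite -/m -/b0 -/(S ord0); congr (_ <= _ + _).
  by apply: eq_Rintegral => x _; congr g; ring.
by apply: eq_Rintegral => x _; rewrite addr0.
Qed.

Lemma standardize_integral P g : finite_moment3 P -> cubic_growth g ->
  \int[standardize P]_x g x = \int[P]_x g ((stddev P)^-1 * (x - mean P)).
Proof.
move=> P3 gg.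
have E x : affine_std (mean P) (stddev P) x = (stddev P)^-1 * (x - mean P).
  by rewrite /affine_std mulrC.
rewrite /Rintegral /standardize integral_distribution.
- by congr fine; apply: eq_integral => x _ /=; rewrite E.
- by apply/measurable_EFinP; exact: cubic_growth_measurable.
- rewrite (_ : _ \o _ = EFin \o (fun x => g ((stddev P)^-1 * (x - mean P))));
  last first.
    by apply/funext => x /=; rewrite E.
  apply: integrable_cubic_growth => //.
  apply: (@cubic_growth_shift R (- mean P) (fun x => g ((stddev P)^-1 * x))).
  exact: cubic_growth_scale.
Qed.

Lemma finite_moment3_standardize P : finite_moment3 P -> finite_moment3 (standardize P).
Proof.
move=> P3.
rewrite /finite_moment3 /standardize ge0_integral_distribution//; last first.
  by apply/measurable_EFinP; apply: cubic_growth_measurable; exact: cubic_growth_norm3.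
have gg := cubic_growth_affine_norm3 (mean P) (stddev P).
by have := integrable_lty measurableT (integrable_cubic_growth P3 gg).
Qed.

End lindeberg.

(** * Norming functionals and Bochner integrals *)

Section hahn_banach.
Context {R : realType} {E : normedModType R}.
Implicit Types (G : set (E * R)) (x v : E) (r t : R).

(* A linear functional dominated by the norm, on a subspace, seen as its graph. *)
Let dominated_graph G :=
  [/\ forall p q, G p -> G q -> G (p + q),
      forall t p, G p -> G (t *: p.1, t * p.2) &
      forall p, G p -> p.2 <= `|p.1|].

Let line v : set (E * R) := [set (t *: v, t * `|v|) | t in [set: R]].

Let dominated_line v : dominated_graph (line v).
Proof.
split.
- move=> _ _ [s _ <-] [t _ <-]; exists (s + t) => //.
  by rewrite scalerDl mulrDl.
- move=> t _ [s _ <-]/=; exists (t * s) => //.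
  by rewrite scalerA mulrA.
- move=> _ [s _ <-]/=; rewrite normrZ.
  by apply: ler_wpM2r => //; exact: ler_norm.
Qed.

(** The value at [x0] must lie above all [p.2 - |p.1 - x0|] and below all [|q.1 + x0| - q.2]. The
    triangle inequality separates the two families, so the supremum of the first will do; scaling by
    [t] handles every multiple of [x0]. *)
Let extend G x0 : dominated_graph G -> G (0, 0) -> exists a : R,
  dominated_graph [set (p.1 + t *: x0, p.2 + t * a) | p in G & t in [set: R]].
Proof.
move=> [GD GZ Gle] G0.
pose S := [set p.2 - `|p.1 - x0| | p in G].
have ub q : G q -> ubound S (`|q.1 + x0| - q.2).
  move=> Gq _ [p Gp <-].
  have /= := Gle _ (GD _ _ Gp Gq).
  have : `|p.1 + q.1| <= `|p.1 - x0| + `|q.1 + x0|.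
    rewrite (_ : p.1 + q.1 = (p.1 - x0) + (q.1 + x0));
      last by rewrite addrACA addNr addr0.
    exact: ler_normD.
  lra.
have S0 : S !=set0 by exists (0 - `|0 - x0|); exists (0, 0).
have supS : has_sup S by split=> //; exists (`|0 + x0| - 0); exact: ub G0.
exists (sup S).
have aL p : G p -> p.2 - `|p.1 - x0| <= sup S.
  by move=> Gp; apply: sup_ubound; [exact: (proj2 supS)|exists p].
have aU p : G p -> sup S <= `|p.1 + x0| - p.2.
  by move=> Gp; apply: ge_sup => //; exact: ub.
split.
- move=> _ _ [p Gp [s _ <-]] [q Gq [t _ <-]]/=.
  exists (p + q); first exact: GD.
  exists (s + t) => //.
  by rewrite scalerDl mulrDl /=; congr (_, _); rewrite addrACA.
- move=> t _ [p Gp [s _ <-]]/=.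
  exists (t *: p.1, t * p.2); first exact: GZ.
  by exists (t * s) => //=; rewrite scalerDr scalerA mulrDr mulrA.
- move=> _ [p Gp [t _ <-]]/=.
  have [t0|t0|->] := ltgtP t 0; last by rewrite scale0r mul0r !addr0; exact: Gle.
    have nt0 : 0 < - t by lra.
    have := aL _ (GZ (- t)^-1 _ Gp) => /=.
    have -> : (- t)^-1 *: p.1 - x0 = (- t)^-1 *: (p.1 + t *: x0).
      by rewrite scalerDr scalerA invrN mulNr mulVf ?lt_eqF// scaleN1r.
    rewrite normrZ gtr0_norm ?invr_gt0// -mulrBr ler_pdivrMl//; lra.
  have := aU _ (GZ t^-1 _ Gp) => /=.
  have -> : t^-1 *: p.1 + x0 = t^-1 *: (p.1 + t *: x0).
    by rewrite scalerDr scalerA mulVf ?gt_eqF// scale1r.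
  rewrite normrZ gtr0_norm ?invr_gt0// -mulrBr ler_pdivlMl//; lra.
Qed.

(** A maximal dominated graph containing [line v] is defined everywhere, by [extend]. Real scalars
    suffice, since a complex space enters through its realification. *)
Lemma norming_functional v : exists l : E -> R,
  [/\ forall x y, l (x + y) = l x + l y,
      forall t x, l (t *: x) = t * l x,
      forall x, `|l x| <= `|x| &
      l v = `|v|].
Proof.
pose Q G := G = set0 \/ (dominated_graph G /\ line v `<=` G).
have [F FQ Ftot|G [QG Gmax]] := @Zorn_bigcup (E * R)%type Q.
  have [F0|] := pselect (forall X, F X -> X = set0).
    by left; apply: bigcup0 => X /F0.
  move=> /existsNP[X /not_implyP[FX X0]].
  have [//|[_ vX]] := FQ _ FX.
  have dom Y : F Y -> Y !=set0 -> dominated_graph Y.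
    by move=> /FQ[->|[]//] /set0P; rewrite eqxx.
  right; split; last first.
    by move=> p /vX Xp; exists X.
  split.
  - move=> p q [Y FY Yp] [Z FZ Zq].
    have [YZ|ZY] := Ftot _ _ FY FZ.
      exists Z => //; have [+ _ _] := dom _ FZ (ex_intro _ _ Zq); apply => //.
      exact: YZ.
    exists Y => //; have [+ _ _] := dom _ FY (ex_intro _ _ Yp); apply => //.
    exact: ZY.
  - move=> t p [Y FY Yp]; exists Y => //.
    by have [_ + _] := dom _ FY (ex_intro _ _ Yp); apply.
  - move=> p [Y FY Yp].
    by have [_ _ +] := dom _ FY (ex_intro _ _ Yp); apply.
have lv : line v (v, `|v|) by exists 1 => //; rewrite scale1r mul1r.
have [domG vG] : dominated_graph G /\ line v `<=` G.
  case: QG => // G0; exfalso; apply: (Gmax (line v)).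
    split; first by rewrite G0.
    by rewrite G0 => /(_ _ lv).
  by right; split.
have [GD GZ Gle] := domG.
have G0 : G (0, 0).
  by apply: vG; exists 0 => //; rewrite scale0r mul0r.
have tot x : exists r, G (x, r).
  apply: contrapT => /forallNP nx.
  have [a domG'] := extend x domG G0.
  set G' := [set _ | p in G & t in _] in domG'.
  have GG' : G `<=` G'.
    by move=> [y r] Gp; exists (y, r) => //; exists 0 => //=;
      rewrite scale0r mul0r !addr0.
  apply: (Gmax G'); last by right; split => // p /vG /GG'.
  split=> // G'G.
  apply: (nx a); apply: G'G; exists (0, 0) => //; exists 1 => //=.
  by rewrite scale1r mul1r !add0r.
have [l lG] := choice tot.
(* Domination makes a graph single-valued: two values over [x] differ by a value over 0, which is at
   most 0. *)
have uniq x r : G (x, r) -> r = l x.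
  move=> Gxr; apply/eqP; rewrite eq_le.
  have h s t : G (x, s) -> G (x, t) -> s <= t.
    move=> Gs Gt; have := Gle _ (GD _ _ Gs (GZ (-1) _ Gt)).
    by rewrite /= scaleN1r subrr normr0 mulN1r subr_le0.
  by rewrite !h.
exists l; split.
- by move=> x y; apply/esym/uniq; exact: (GD _ _ (lG x) (lG y)).
- by move=> t x; apply/esym/uniq; exact: (GZ t _ (lG x)).
- move=> x; rewrite ler_norml; apply/andP; split; last exact: (Gle _ (lG x)).
  have := Gle _ (GZ (-1) _ (lG x)); rewrite /= scaleN1r normrN mulN1r; lra.
- exact/esym/uniq/vG.
Qed.

End hahn_banach.

Section second_difference.
Context {R : realType}.
Implicit Types (g dg : R -> R) (t x y z L : R).

(** The hypothesis makes [L t + dg t] nondecreasing, so [g t + L / 2 * t ^ 2] is convex; the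
    conclusion is this convexity, proved by two mean values. *)
Lemma second_difference_le L g dg : (forall x, is_derive x 1 g (dg x)) ->
  (forall x y, x <= y -> dg x - dg y <= L * (y - x)) ->
  forall x y z, x < y -> y < z ->
  (z - x) * g y - ((z - y) * g x + (y - x) * g z)
    <= L / 2 * ((z - x) * (y - x) * (z - y)).
Proof.
move=> gdg mono x y z xy yz.
have dN (t : R) : is_derive t 1 (fun t => - g t) (- dg t) by apply: is_deriveN.
have dG t := @is_derive_poly_sub R 0 0 (L / 2) 0 (fun t => - g t) (fun t => - dg
  t) t (dN t).
have [c1 [xc1 c1y E1]] := MVT_global xy dG.
have [c2 [yc2 c2z E2]] := MVT_global yz dG.
have := mono c1 c2 (ltW (lt_trans c1y yc2)).
move=> h; rewrite -subr_ge0.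
have : 0 <= ((L * c2 + dg c2) - (L * c1 + dg c1)) * ((z - y) * (y - x)).
  by rewrite !mulr_ge0//; lra.
move: E1 E2; set d1 := dg c1; set d2 := dg c2 => E1 E2.
have F1 : g y - g x = (L * c1 + d1) * (y - x) - L / 2 * (y ^+ 2 - x ^+ 2) by lra.
have F2 : g z - g y = (L * c2 + d2) * (z - y) - L / 2 * (z ^+ 2 - y ^+ 2) by lra.
have -> : (z - x) * g y - ((z - y) * g x + (y - x) * g z) =
  (z - y) * (g y - g x) - (y - x) * (g z - g y) by ring.
rewrite F1 F2; lra.
Qed.

End second_difference.

(** * Reduction to scalar functions by functionals of norm at most 1 *)

Section functionals.
Context {R : realType} {E : normedModType R}.
Implicit Types (l : E -> R) (f : R -> E).

Definition contractive_functional l := [/\ forall x y, l (x + y) = l x + l y,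
  forall t x, l (t *: x) = t * l x & forall x, `|l x| <= `|x|].

Variables (l : E -> R) (hl : contractive_functional l).

Lemma functionalB x y : l (x - y) = l x - l y.
Proof. by have [lD lZ _] := hl; rewrite lD -scaleN1r lZ mulN1r. Qed.

Lemma functional_continuous : continuous l.
Proof.
have [_ _ ll] := hl.
move=> x; apply/cvgrPdist_lt => e e0.
near=> y; rewrite -functionalB; apply: le_lt_trans (ll _) _.
near: y; exact: cvgr_dist_lt.
Unshelve. all: by end_near. Qed.

Lemma functional_is_derive f x : derivable f x 1 ->
  is_derive x 1 (l \o f) (l (f^`() x)).
Proof.
have [lD lZ _] := hl.
move=> dfx.
have : h^-1 *: ((l \o f) (h *: 1 + x) - (l \o f) x) @[h --> 0^'] --> l (f^`() x).
  rewrite derive1E (_ : (fun h => _) = l \o (fun h => h^-1 *: (f (h *: 1 + x) - f x))).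
    exact: cvg_comp dfx (@functional_continuous ('D_1 f x)).
  by apply/funext => h /=; rewrite lZ functionalB.
move=> H; apply: DeriveDef; first by apply/cvg_ex; exists (l (f^`() x)).
exact: cvg_lim H.
Qed.

Lemma lipschitz_seminorm_le (g : R -> E) x y : (lipschitz_seminorm g < +oo)%E ->
  `|g x - g y| <= fine (lipschitz_seminorm g) * `|x - y|.
Proof.
move=> goo; have [->|xy] := eqVneq x y; first by rewrite !subrr !normr0 mulr0.
have H : ((`|g x - g y| / `|x - y|)%:E <= lipschitz_seminorm g)%E.
  by apply: ereal_sup_ubound; exists (x, y).
have gfin : lipschitz_seminorm g \is a fin_num.
  by rewrite fin_numElt goo (lt_le_trans _ H)// ltNyr.
by move: H; rewrite -(fineK gfin) lee_fin ler_pdivrMr// normr_gt0 subr_eq0.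
Qed.

Lemma lipschitz_seminorm_ge0 (g : R -> E) : 0 <= fine (lipschitz_seminorm g).
Proof.
apply: fine_ge0; apply: (@le_trans _ _ (`|g 0 - g 1| / `|0 - 1|)%:E).
  by rewrite lee_fin divr_ge0.
by apply: ereal_sup_ubound; exists (0, 1) => //=; rewrite eq_sym oner_eq0.
Qed.

(** A contractive [l] does not enlarge the Lipschitz constant; [second_difference_le], for the
    derivative of [l \o f] and for its negative, gives the two sides of the absolute value. *)
Lemma functional_cubic_smooth f : C21 f ->
  cubic_smooth (fine (lipschitz_seminorm f^`(2))) (l \o f) (l \o f^`()).
Proof.
move=> [df ddf _ Loo]; have [_ _ ll] := hl.
set L := fine _.
have d1 x := functional_is_derive (df x).
have d2 x := functional_is_derive (ddf x).
have lip x y : `|l (f^`(2) x) - l (f^`(2) y)| <= L * `|x - y|.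
  rewrite -functionalB; apply: le_trans (ll _) _; exact: lipschitz_seminorm_le.
split=> //.
  by move=> x; apply/differentiable_continuous/derivable1_diffP; case: (d2 x).
have gen := @second_difference_le R L.
have lipW x y : x <= y -> `|l (f^`(2) x) - l (f^`(2) y)| <= L * (y - x).
  by move=> xy; apply: le_trans (lip x y) _; rewrite distrC ger0_norm// subr_ge0.
move=> x y z xy yz; rewrite ler_norml; apply/andP; split.
  rewrite lerNl opprB.
  apply: (gen (l \o f^`()) (fun x => l (f^`(2) x)) d2 _ _ _ _ xy yz) => s t st.
  exact: le_trans (ler_norm _) (lipW s t st).
have dN (t : R) : is_derive t (1 : R) (fun t => - l (f^`() t)) (- l (f^`(2) t)).
  exact: is_deriveN (d2 t).
have mN s t : s <= t -> - l (f^`(2) s) - - l (f^`(2) t) <= L * (t - s).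
  move=> st; rewrite opprK addrC.
  by apply: le_trans (lipW s t st); rewrite distrC ler_norm.
have := gen (fun x => - l (f^`() x)) (fun x => - l (f^`(2) x)) dN mN x y z xy yz.
rewrite /=; lra.
Qed.

End functionals.

Section growth_of_C21.
Context {R : realType} {E : normedModType R}.

(** Bochner integrability needs a bound on the norm itself. For each [x] a functional norming [f x]
    allows two applications of the scalar mean value theorem, and the resulting constant does not
    depend on the functional. *)
Lemma C21_cubic_growth (f : R -> E) : C21 f ->
  exists2 C, 0 <= C & forall x, `|f x| <= C * (1 + `|x| ^+ 3).
Proof.
move=> Cf; have [df ddf _ Loo] := Cf.
set L := fine (lipschitz_seminorm f^`(2)).
have L0 : 0 <= L := lipschitz_seminorm_ge0 _.
pose f1 : R -> E := f^`(); pose f2 : R -> E := f^`(2).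
pose a := `|f 0|; pose b := `|f^`() 0|; pose c := `|f^`(2) 0|.
have mvt (g dg : R -> R) M x : (forall x : R, is_derive x (1 : R) g (dg x)) ->
    (forall t, `|t| <= `|x| -> `|dg t| <= M) -> `|g x| <= `|g 0| + M * `|x|.
  move=> gdg gM.
  suff : `|g x - g 0| <= M * `|x|.
    have := ler_normD (g x - g 0) (g 0); rewrite subrK; lra.
  have [x0|x0|->] := ltgtP x 0; last by rewrite subrr !normr0 mulr0.
    have [t [xt t0 E1]] := MVT_global x0 gdg.
    rewrite distrC E1 normrM sub0r normrN ler_wpM2r// gM//.
    by rewrite (ltr0_norm t0) (ltr0_norm x0) lerN2 ltW.
  have [t [t0 tx E1]] := MVT_global x0 gdg.
  rewrite E1 normrM subr0 ler_wpM2r// gM//.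
  by rewrite (gtr0_norm t0) (gtr0_norm x0) ltW.
have a0 : 0 <= a := normr_ge0 _.
have b0 : 0 <= b := normr_ge0 _.
have c0 : 0 <= c := normr_ge0 _.
exists (a + b + c + L); first by rewrite !addr_ge0.
move=> x.
have [l [lD lZ ll lf]] := norming_functional (f x).
have hl : contractive_functional l by [].
have d1 x := functional_is_derive hl (df x).
have d2 x := functional_is_derive hl (ddf x).
have fx2 t : `|l (f2 t)| <= c + L * `|t|.
  apply: le_trans (ll _) _.
  have := lipschitz_seminorm_le t 0 Loo; rewrite subr0 -/L.
  have := ler_normD (f2 t - f2 0) (f2 0); rewrite subrK -/c; lra.
have fx1 t : `|t| <= `|x| -> `|l (f1 t)| <= b + (c + L * `|x|) * `|x|.
  move=> tx; apply: le_trans (mvt _ _ (c + L * `|x|) t d2 _) _ => [s st|].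
    by apply: le_trans (fx2 s) _; rewrite lerD2l ler_wpM2l//; lra.
  apply: lerD; first exact: ll.
  by rewrite ler_wpM2l// addr_ge0// mulr_ge0.
have := mvt _ _ _ x d1 fx1; rewrite /= lf normr_id.
have := ll (f 0); rewrite -/a.
have y0 := normr_ge0 x.
set y := `|x| in y0 *.
move=> h1 h2; apply: (le_trans h2).
have y1 : y <= 1 + y ^+ 3.
  rewrite -subr_ge0; have -> : 1 + y ^+ 3 - y = (y - 1) ^+ 2 * (y + 1) + y ^+ 2 by ring.
  by rewrite addr_ge0 ?sqr_ge0// mulr_ge0 ?sqr_ge0// addr_ge0.
have y2 : y ^+ 2 <= 1 + y ^+ 3.
  rewrite -subr_ge0; have -> : 1 + y ^+ 3 - y ^+ 2 = (y - 1) ^+ 2 * (y + 1) + y by ring.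
  by rewrite addr_ge0// mulr_ge0 ?sqr_ge0// addr_ge0.
have y3 := exprn_ge0 3 y0.
have -> : `|l (f 0)| + (b + (c + L * y) * y) * y = `|l (f 0)| + b * y + c * y ^+
  2 + L * y ^+ 3 by ring.
have -> : (a + b + c + L) * (1 + y ^+ 3) = a * (1 + y ^+ 3) + b * (1 + y ^+ 3) +
  c * (1 + y ^+ 3) + L * (1 + y ^+ 3) by ring.
apply: lerD; last by rewrite ler_wpM2l//; lra.
apply: lerD; last by rewrite ler_wpM2l//; lra.
apply: lerD; last by rewrite ler_wpM2l//; lra.
by apply: (le_trans h1); rewrite ler_peMr//; lra.
Qed.

End growth_of_C21.

(** * Bochner integrals and functionals *)

Section bochner_functional.
Context {R : realType} {E : completeNormedModType R}.
Implicit Types (P : law R) (f s : measurableTypeR R -> E) (l : E -> R).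

(** The second argument of [g] lets one expansion serve both for [l (s x)] and for the distance from
    [f x] to [s x]. *)
Lemma simple_fun_sum s (g : E -> measurableTypeR R -> R) x : finite_set (range s) ->
  g (s x) x = \sum_(v <- fset_set (range s)) g v x * \1_(s @^-1` [set v]) x.
Proof.
move=> fs.
have sx : s x \in fset_set (range s) by rewrite in_fset_set; [apply/mem_set; exists x|].
rewrite (bigD1_seq (s x))//=; last exact: fset_uniq.
rewrite big1 => [|v vsx]; last first.
  rewrite indicE memNset ?mulr0//= => sv.
  by move: vsx; rewrite sv eqxx.
by rewrite indicE mem_set ?mulr1 ?addr0.
Qed.

Lemma measurable_dist_simple f s : continuous (f : R -> E) -> simple_fun s ->
  measurable_fun setT (fun x => `|f x - s x|).
Proof.
move=> cf [fs ms].
rewrite (_ : (fun x => _) = (fun x => \sum_(v <- fset_set (range s))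
    `|f x - v| * \1_(s @^-1` [set v]) x)); last first.
  by apply/funext => x; rewrite -(simple_fun_sum (fun v x => `|f x - v|)).
apply: measurable_sum => v; apply: measurable_funM.
  have : continuous (fun x : R => `|f x - v|).
    move=> x; apply: cvg_norm; apply: cvgB; [exact: cf|exact: cvg_cst].
  exact: continuous_measurable_fun.
exact: measurable_indic.
Qed.

Lemma simple_integral_functional P s l : contractive_functional l -> simple_fun s ->
  P.-integrable setT (EFin \o (l \o s)) /\
  l (simple_integral P s) = \int[P]_x l (s x).
Proof.
move=> [lD lZ ll] [fs ms].
have l0 : l 0 = 0 by have := lZ 0 0; rewrite scale0r mul0r.
have lsum : {morph l : x y / x + y >-> x + y} by [].
have mS v : measurable (s @^-1` [set v]) by [].
have iv v : P.-integrable setT (fun x => (l v)%:E * (\1_(s @^-1` [set v]) x)%:E)%E.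
  by apply: integrableZl => //; exact: integrable_indic.
have E1 : EFin \o (l \o s) = (fun x => \sum_(v <- fset_set (range s))
    (l v)%:E * (\1_(s @^-1` [set v]) x)%:E)%E.
  apply/funext => x /=.
  rewrite (simple_fun_sum (fun v _ => l v) x fs) -sumEFin.
  by apply: eq_bigr => v _; rewrite EFinM.
split; first by rewrite E1; exact: integrable_sum.
rewrite /simple_integral fsbig_finite// (big_morph l lsum l0).
rewrite /Rintegral -[X in fine (integral _ _ X)]/(EFin \o (l \o s)) E1.
rewrite integral_sum//.
have Ei v : (\int[P]_x ((l v)%:E * (\1_(s @^-1` [set v]) x)%:E) =
    (fine (P (s @^-1` [set v])) * l v)%:E)%E.
  rewrite integralZl//; last exact: integrable_indic.
  rewrite integral_indic// setIT mulrC EFinM fineK//.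
  exact: fin_num_measure.
under eq_bigr do rewrite lZ.
by under [in RHS]eq_bigr do rewrite Ei; rewrite sumEFin.
Qed.

Lemma functional_dist_simple P f s l : contractive_functional l ->
  continuous (f : R -> E) -> P.-integrable setT (EFin \o (l \o f)) ->
  simple_fun s -> (\int[P]_x (`|f x - s x|)%:E < +oo)%E ->
  `|\int[P]_x l (f x) - l (simple_integral P s)| <= \int[P]_x `|f x - s x|.
Proof.
move=> hl cf ilf hs fin.
have [ils ->] := simple_integral_functional P hl hs.
have md := measurable_dist_simple cf hs.
have id : P.-integrable setT (EFin \o (fun x => `|f x - s x|)).
  apply/integrableP; split; first exact/measurable_EFinP.
  by under eq_integral do rewrite /= normr_id.
rewrite -RintegralB//.
have ilB : P.-integrable setT (EFin \o (fun x => l (f x) - l (s x))).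
  exact: (integrableB measurableT ilf ils).
apply: (le_trans (le_normr_Rintegral measurableT ilB)).
apply: le_Rintegral => //.
  exact: (integrable_norm ilB).
by move=> x _; rewrite -(functionalB hl); have [_ _] := hl; apply.
Qed.

(** The images under [l] of the simple integrals tend to [l I] by continuity, and to the scalar
    integral by [functional_dist_simple]. *)
Lemma functional_bochner P f I l : contractive_functional l ->
  continuous (f : R -> E) -> P.-integrable setT (EFin \o (l \o f)) ->
  is_bochner_integral P f I -> l I = \int[P]_x l (f x).
Proof.
move=> hl cf ilf [s [hs _ d0 sI]].
have lI : l (simple_integral P (s k)) @[k --> \oo] --> l I.
  exact: (cvg_comp _ _ sI (@functional_continuous _ _ _ hl I)).
have [/= dfin d0'] := (fine_cvgP _ _).1 d0.
have lJ : l (simple_integral P (s k)) @[k --> \oo] --> \int[P]_x l (f x).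
  apply/cvgrPdist_lt => e e0.
  have de : \forall k \near \oo, \int[P]_x `|f x - s k x| < e.
    move/cvgrPdist_lt : d0' => /(_ e e0); apply: filterS => k /=.
    by rewrite sub0r normrN; apply: le_lt_trans; exact: ler_norm.
  near=> k.
  have finE : (\int[P]_x (`|f x - s k x|)%:E \is a fin_num)%E by near: k.
  apply: (@le_lt_trans _ _ (\int[P]_x `|f x - s k x|)).
    apply: functional_dist_simple => //.
    by move: finE; rewrite fin_numElt => /andP[].
  by near: k.
exact: (cvg_unique _ lI lJ).
Unshelve. all: by end_near. Qed.

End bochner_functional.

Import HBNNSimple.

(** * Existence of Bochner integrals *)

Section bochner_existence.
Context {R : realType}.
Implicit Types (P : law R) (k : nat) (x : R).

(** Composing a continuous [f] with these functions gives simple functions converging to [f], and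
    [|phi k x| <= |x|] lets the growth bound of [f] dominate them. *)
Lemma simple_approx_id : exists phi : nat -> measurableTypeR R -> R,
  [/\ forall k, finite_set (range (phi k)),
      forall k, measurable_fun setT (phi k),
      forall k x, `|phi k x| <= `|x| &
      forall x, phi k x @[k --> \oo] --> x].
Proof.
pose pos (x : measurableTypeR R) : \bar R := (Num.max x 0)%:E.
pose neg (x : measurableTypeR R) : \bar R := (Num.max (- x) 0)%:E.
have cmax : continuous (fun x : R => Num.max x 0).
  move=> x; apply: (@continuous_max _ _ id (cst 0)); first exact: cvg_id.
  exact: cvg_cst.
have mpos : measurable_fun setT pos.
  by apply/measurable_EFinP; exact: continuous_measurable_fun cmax.
have mneg : measurable_fun setT neg.
  apply/measurable_EFinP;
    apply: (@continuous_measurable_fun R (fun x => Num.max (- x) 0)).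
  move=> x; apply: (@continuous_comp _ _ _ -%R (fun x : R => Num.max x 0));
    last exact: cmax.
  exact: continuousN.
pose A k : measurableTypeR R -> R := nnsfun_approx measurableT mpos k.
pose B k : measurableTypeR R -> R := nnsfun_approx measurableT mneg k.
have limA x : A k x @[k --> \oo] --> Num.max x 0.
  have p0 y : setT y -> (0 <= pos y)%E by rewrite lee_fin le_max lexx orbT.
  exact: fine_cvg (cvg_nnsfun_approx measurableT mpos p0 (I : setT x)).
have limB x : B k x @[k --> \oo] --> Num.max (- x) 0.
  have p0 y : setT y -> (0 <= neg y)%E by rewrite lee_fin le_max lexx orbT.
  exact: fine_cvg (cvg_nnsfun_approx measurableT mneg p0 (I : setT x)).
have leA k x : A k x <= Num.max x 0.
  rewrite -(cvg_lim _ (limA x))//; apply: nondecreasing_cvgn_le; last first.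
    by apply/cvg_ex; exists (Num.max x 0).
  by move=> i j ij; have /lefP := nd_nnsfun_approx measurableT mpos ij; exact.
have leB k x : B k x <= Num.max (- x) 0.
  rewrite -(cvg_lim _ (limB x))//; apply: nondecreasing_cvgn_le; last first.
    by apply/cvg_ex; exists (Num.max (- x) 0).
  by move=> i j ij; have /lefP := nd_nnsfun_approx measurableT mneg ij; exact.
exists (fun k x => A k x - B k x); split.
- move=> k.
  have fA : finite_set (range (A k)) by exact: fimfunP.
  have fB : finite_set (range (B k)) by exact: fimfunP.
  have := finite_image2 (fun a b => a - b) fA fB.
  apply: sub_finite_set => _ [x _ <-] /=.
  exists (A k x); first by exists x.
  by exists (B k x) => //; exists x.
- by move=> k; apply: measurable_funB.
- move=> k x.
  have A0 : 0 <= A k x by exact: fun_ge0.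
  have B0 : 0 <= B k x by exact: fun_ge0.
  have := leA k x; have := leB k x.
  have [x0|x0] := lerP 0 x.
    rewrite max_r ?oppr_le0// => h1 h2.
    by rewrite (ger0_norm x0) ler_norml; lra.
  have nx0 : 0 <= - x by lra.
  rewrite (max_l nx0) => h1 h2.
  by rewrite (ltr0_norm x0) ler_norml; lra.
- move=> x.
  rewrite [X in _ --> X](_ : x = Num.max x 0 - Num.max (- x) 0).
    exact: cvgB (limA x) (limB x).
  have [x0|x0] := lerP 0 x; first by rewrite max_r ?oppr_le0// subr0.
  have nx0 : 0 <= - x by lra.
  by rewrite (max_l nx0) sub0r opprK.
Qed.

Lemma continuous_bochner_integrable (E : completeNormedModType R) P (f : R -> E) :
  finite_moment3 P -> continuous f ->
  (exists2 C, 0 <= C & forall x, `|f x| <= C * (1 + `|x| ^+ 3)) ->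
  bochner_integrable P (f : measurableTypeR R -> E).
Proof.
move=> P3 cf [C C0 fC].
have [phi [fphi mphi lephi cvgphi]] := simple_approx_id.
pose s k : measurableTypeR R -> E := f \o phi k.
have hs k : simple_fun (s k).
  split.
    have := finite_image f (fphi k).
    by apply: sub_finite_set => _ [x _ <-] /=; exists (phi k x) => //; exists x.
  move=> v.
  have -> : s k @^-1` [set v] =
    [set: measurableTypeR R] `&` phi k @^-1` (f @^-1` [set v]).
    by rewrite setTI.
  apply: (mphi k) => //; apply: closed_measurable.
  apply: (closed_comp (f := f)); first by move=> x _; exact: cf.
  exact/accessible_closed_set1/hausdorff_accessible/norm_hausdorff.
have scvg (x : R) : s k x @[k --> \oo] --> f x.
  exact: (cvg_comp _ _ (cvgphi x) (cf x)).
pose G x := 2 * (C * (1 + `|x| ^+ 3)).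
have iG : P.-integrable setT (EFin \o G).
  apply: integrable_cubic_growth => //; apply: cubic_growthZ; apply: cubic_growthZ.
  by apply: cubic_growthD; [exact: cubic_growth_cst|exact: cubic_growth_norm3].
have d0 : (\int[P]_x (`|f x - s k x|)%:E)%E @[k --> \oo] --> 0%E.
  have [| | | | |_ _] := @dominated_convergence _ _ _ P setT measurableT
    (fun k x => (`|f x - s k x|)%:E) (cst 0%E) (EFin \o G).
  - by move=> k; apply/measurable_EFinP; exact: measurable_dist_simple.
  - exact: measurable_cst.
  - apply/aeW => x _; apply: cvg_EFin; first exact: nearW.
    have := cvg_norm (cvgB (cvg_cst (f x)) (scvg x)).
    by rewrite subrr normr0; apply.
  - exact: iG.
  - apply/aeW => x k _ /=; rewrite lee_fin normr_id.
    apply: (le_trans (ler_normB _ _)).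
    have := fC x; have := fC (phi k x); rewrite -/(s k x).
    have : `|phi k x| ^+ 3 <= `|x| ^+ 3 by rewrite ler_pXn2r ?nnegrE// lephi.
    rewrite /G; nra.
  by rewrite integral0.
have [/= dfin d0'] := (fine_cvgP _ _).1 d0.
suff : cvgn (fun k => simple_integral P (s k)).
  by move=> /cvg_ex[I sI]; exists I, s; split.
apply/cauchy_cvgP; apply: cauchy_exP => e e0.
have e20 : 0 < e / 2 by rewrite divr_gt0.
have near_small : \forall k \near \oo,
    (\int[P]_x (`|f x - s k x|)%:E \is a fin_num)%E /\ \int[P]_x `|f x - s k x| < e / 2.
  apply: filterI => //.
  move/cvgrPdist_lt : d0' => /(_ _ e20); apply: filterS => k /=.
  by rewrite sub0r normrN; apply: le_lt_trans; exact: ler_norm.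
have [N _ HN] := near_small.
exists (simple_integral P (s N)).
exists N => //= k Nk.
rewrite -ball_normE /=.
(* For a functional norming the difference of two simple integrals, both images lie within [e / 2]
   of the integral of [l \o f]; so the sequence is Cauchy. *)
have [l [lD lZ ll <-]] :=
  norming_functional (simple_integral P (s N) - simple_integral P (s k)).
have hl : contractive_functional l by [].
rewrite (functionalB hl).
have ilf : P.-integrable setT (EFin \o (l \o f)).
  apply: integrable_cubic_growth => //; split.
    by move=> x; apply: continuous_comp; [exact: cf|exact: functional_continuous].
  by exists C => // x; apply: le_trans (ll _) (fC x).
have err i : (N <= i)%N -> `|\int[P]_x l (f x) - l (simple_integral P (s i))| < e / 2.
  move=> /HN[finE]; apply: le_lt_trans; apply: functional_dist_simple => //.
  by move: finE; rewrite fin_numElt => /andP[].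
have := err N (leqnn N); have := err k Nk; rewrite !ltr_norml; lra.
Qed.

End bochner_existence.

(** * The inequality and the equality case *)

Section two_point_laws.
Context {R : realType}.
Implicit Types (P : law R) (p q r D : R).

(** For weights [p] and [q], with [r = sqrt (p q)], the third absolute moment is [1 / r - 2 r]. Both
    radicands in [B] then become squares. *)
Lemma B_two_point p q r : p + q = 1 -> 0 < r -> r ^+ 2 = p * q ->
  B ((p ^+ 2 + q ^+ 2) / r) = `|q - p| / r.
Proof.
move=> pq r0 rE; rewrite /B.
have qE : q = 1 - p by lra.
have r0' : r != 0 by rewrite gt_eqF.
have -> : (p ^+ 2 + q ^+ 2) / r = r^-1 - 2 * r.
  have -> : p ^+ 2 + q ^+ 2 = 1 - 2 * r ^+ 2 by rewrite rE qE; ring.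
  by field.
have -> : (r^-1 - 2 * r) ^+ 2 + 8 = (r^-1 + 2 * r) ^+ 2 by field.
have ri0 : 0 < r^-1 by rewrite invr_gt0.
rewrite sqrtr_sqr (ger0_norm (_ : 0 <= r^-1 + 2 * r)); last by lra.
have -> : (r^-1 - 2 * r) ^+ 2 / 2 + (r^-1 - 2 * r) / 2 * (r^-1 + 2 * r) - 2 =
    ((q - p) / r) ^+ 2.
  have -> : ((q - p) / r) ^+ 2 = (q - p) ^+ 2 / r ^+ 2 by field.
  have -> : (q - p) ^+ 2 = 1 - 4 * r ^+ 2 by rewrite rE qE; ring.
  by field.
by rewrite sqrtr_sqr normrM normfV (gtr0_norm r0).
Qed.

(** The equality case for one summand. The centred atoms are [q D] and [- p D], where [D] is the
    signed gap, and the standard deviation is [r * |D|]. *)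
Lemma two_point_centred_moment3 P : P3 P -> two_point_law P ->
  `|centred_moment3 P| = stddev P ^+ 3 * B (std_abs_moment3 P).
Proof.
move=> P3P [a [b [p [ab /andP[p0 p1] PE]]]].
have p01 : 0 <= p <= 1 by rewrite !ltW.
have I g : cubic_growth g -> \int[P]_x g x = p * g a + (1 - p) * g b.
  by move=> gg; apply: (two_point_integral p01 PE); exact: cubic_growth_measurable.
pose q := 1 - p; pose D := a - b; pose r := Num.sqrt (p * q).
have q0 : 0 < q by rewrite /q; lra.
have pq0 : 0 < p * q by exact: mulr_gt0.
have r0 : 0 < r by rewrite sqrtr_gt0.
have rE : r ^+ 2 = p * q by rewrite sqr_sqrtr// ltW.
have D0 : 0 < `|D| by rewrite normr_gt0 subr_eq0.
have pq : p + q = 1 by rewrite /q; ring.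
have mE : mean P = p * a + q * b by rewrite meanE I//; exact: (@cubic_growth_expr R 1).
have aE : a - mean P = q * D by rewrite mE /D /q; ring.
have bE : b - mean P = - p * D by rewrite mE /D /q; ring.
have VE : stddev P = r * `|D|.
  rewrite /stddev varE I ?aE ?bE -/q; last first.
    by apply: (@cubic_growth_shift R _ (fun x => x ^+ 2)); exact: cubic_growth_expr.
  have -> : p * (q * D) ^+ 2 + q * (- p * D) ^+ 2 = (p * q) * D ^+ 2 * (p + q) by ring.
  by rewrite pq mulr1 sqrtrM ?sqrtr_sqr// ltW.
have cE : centred_moment3 P = r ^+ 2 * (q - p) * D ^+ 3.
  rewrite centred_moment3E I ?aE ?bE -/q; last first.
    by apply: (@cubic_growth_shift R _ (fun x => x ^+ 3)); exact: cubic_growth_expr.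
  have -> : p * (q * D) ^+ 3 + q * (- p * D) ^+ 3 = (p * q) * ((q - p) * (p +
    q)) * D ^+ 3 by ring.
  by rewrite pq mulr1 rE.
have rhoE : std_abs_moment3 P = (p ^+ 2 + q ^+ 2) / r.
  rewrite std_abs_moment3E I; last exact: cubic_growth_affine_norm3.
  rewrite aE bE -/q VE !normrM normrN !normfV normrM normr_id.
  rewrite (gtr0_norm q0) (gtr0_norm p0) (gtr0_norm r0).
  have -> : p * (q * `|D| / (r * `|D|)) ^+ 3 + q * (p * `|D| / (r * `|D|)) ^+ 3 =
     (p * q) * (p ^+ 2 + q ^+ 2) / r ^+ 3 by field; rewrite !gt_eqF.
  by rewrite -rE; field; rewrite gt_eqF.
rewrite rhoE B_two_point// cE VE (normrM (_ * _)) (normrM (r ^+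
  2)) !normrX (gtr0_norm r0).
by field; rewrite gt_eqF.
Qed.

End two_point_laws.

(** * Standardized convolutions *)

Section standardized_convolution.
Context {R : realType} (E : completeNormedModType R).
Variables (n : nat) (P : 'I_n -> law R).
Hypotheses (n0 : (0 < n)%N) (P3P : forall i, P3 (P i)).

Let sigma_ i := stddev (P i).
Let Q i := symmetric_law (sigma_ i).
Let sigma := Num.sqrt (\sum_(i < n) sigma_ i ^+ 2).
Let Pn := standardize (convolutions P).
Let Qn := standardize (convolutions Q).

Let fP : finite_moment3 (convolutions P).
Proof. by apply: finite_moment3_convolutions => i; exact: P3_finite_moment3. Qed.

Let fQ : finite_moment3 (convolutions Q).
Proof. by apply: finite_moment3_convolutions => i;
  exact: finite_moment3_symmetric_law. Qed.

Let sigma_gt0 : 0 < sigma.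
Proof.
rewrite sqrtr_gt0; case: n n0 P P3P @sigma_ => // k _ P' P3' s.
rewrite big_ord_recl ltr_wpDr//; first by apply: sumr_ge0 => i _; exact: sqr_ge0.
by rewrite exprn_gt0// /s stddev_gt0.
Qed.

Let stddevP : stddev (convolutions P) = sigma.
Proof.
rewrite /stddev var_convolutions; last by move=> i; exact: P3_finite_moment3.
by congr Num.sqrt; apply: eq_bigr => i _; rewrite -sqr_stddev.
Qed.

Let stddevQ : stddev (convolutions Q) = sigma.
Proof.
rewrite /stddev var_convolutions; last by move=> i; exact: finite_moment3_symmetric_law.
by congr Num.sqrt; apply: eq_bigr => i _; rewrite var_symmetric_law.
Qed.

Let meanQ : mean (convolutions Q) = 0.
Proof.
rewrite mean_convolutions; last by move=> i; exact: finite_moment3_symmetric_law.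
by rewrite big1// => i _; rewrite mean_symmetric_law.
Qed.

(** Each [Q i] has the variance of [P i], so both convolutions are scaled by the same [sigma], and
    [lindeberg] applies to [g (sigma^-1 * x)] with constant [L / sigma ^ 3]. *)
Lemma standardized_convolution_le L g dg : 0 <= L -> cubic_smooth L g dg ->
  \int[Pn]_x g x - \int[Qn]_x g x <=
  L / 6 * \sum_(i < n) sigma_ i ^+ 3 / sigma ^+ 3 * B (std_abs_moment3 (P i)).
Proof.
move=> L0 K; have gg := cubic_smooth_growth L0 K.
have s0 : 0 < sigma^-1 by rewrite invr_gt0.
have L0' : 0 <= L * sigma^-1 ^+ 3 by rewrite mulr_ge0// exprn_ge0// ltW.
rewrite !standardize_integral// stddevP stddevQ meanQ.
rewrite mean_convolutions; last by move=> i; exact: P3_finite_moment3.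
have := lindeberg P3P L0' (cubic_smooth_scale s0 K).
rewrite -/Q lerBlDl => /le_trans; apply.
have -> : \int[convolutions Q]_x g (sigma^-1 * (x - 0)) =
  \int[convolutions Q]_x g (sigma^-1 * x).
  by apply: eq_Rintegral => x _; rewrite subr0.
rewrite lerD2l !mulr_sumr; apply: ler_sum => i _.
rewrite le_eqVlt; apply/orP; left; apply/eqP; rewrite -/(sigma_ i) exprVn; ring.
Qed.

Lemma standardized_convolution_moment3 :
  \int[Pn]_x (x ^+ 3) = (\sum_(i < n) centred_moment3 (P i)) / sigma ^+ 3 /\
  \int[Qn]_x (x ^+ 3) = 0.
Proof.
have c3 := @cubic_growth_expr R 3 isT.
have I (S : law R) : finite_moment3 S ->
    \int[S]_x (((sigma^-1 * (x - mean S)) ^+ 3)) = centred_moment3 S / sigma ^+ 3.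
  move=> fS; rewrite centred_moment3E mulrC -exprVn -RintegralZ_growth//; last first.
    by apply: (@cubic_growth_shift R _ (fun x => x ^+ 3)); exact: cubic_growth_expr.
  by apply: eq_Rintegral => x _; rewrite exprMn.
split.
  rewrite standardize_integral// stddevP I// centred_moment3_convolutions//.
  by move=> i; exact: P3_finite_moment3.
rewrite standardize_integral// stddevQ I// centred_moment3_convolutions; last first.
  by move=> i; exact: finite_moment3_symmetric_law.
by rewrite big1 ?mul0r// => i _; exact: centred_moment3_symmetric_law.
Qed.

End standardized_convolution.

(** * Cubic functions, for the equality case *)

Section cube.
Context {R : realType} {E : normedModType R}.

Lemma functional_separates (x y : E) :
  (forall l : E -> R, contractive_functional l -> l x = l y) -> x = y.
Proof.
move=> H; apply/eqP; rewrite -subr_eq0 -normr_eq0.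
have [l [lD lZ ll <-]] := norming_functional (x - y).
have hl : contractive_functional l by [].
by rewrite functionalB// (H _ hl) subrr.
Qed.

(** The second derivative is identified by testing against functionals, which reduces it to
    derivatives of real polynomials. *)
Lemma cube_lipschitz_seminorm (f : R -> E) (c : E) : C21 f ->
  (forall x, f x = x ^+ 3 *: c) -> fine (lipschitz_seminorm f^`(2)) = 6 * `|c|.
Proof.
move=> [df ddf _ Loo] fE.
have f2E x : f^`(2) x = (6 * x) *: c.
  apply: functional_separates => l hl; have [_ lZ _] := hl.
  have d1 y := functional_is_derive hl (df y).
  have d2 y := functional_is_derive hl (ddf y).
  have E1 : l \o f^`() = (fun y => (3 * l c) * y ^+ 2).
    apply/funext => y /=.
    have h : is_derive y (1 : R) (fun y : R => 0 + 0 * y + 0 * y ^+ 2 + l c * y ^+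
      3 - cst 0 y)
       (0 + 2 * 0 * y + 3 * l c * y ^+ 2 - 0).
      exact: (@is_derive_poly_sub R 0 0 0 (l c) (cst 0) (cst 0)).
    have : l \o f = (fun y : R => 0 + 0 * y + 0 * y ^+ 2 + l c * y ^+ 3 - cst 0 y).
      by apply/funext => z; rewrite /= fE lZ; ring.
    have := @derive_val _ _ _ _ _ _ _ (d1 y) => <- ->.
    by rewrite (@derive_val _ _ _ _ _ _ _ h); ring.
  have h : is_derive x (1 : R) (fun y : R => 0 + 0 * y + (3 * l c) * y ^+ 2 +
    0 * y ^+ 3 - cst 0 y)
     (0 + 2 * (3 * l c) * x + 3 * 0 * x ^+ 2 - 0).
    exact: (@is_derive_poly_sub R 0 0 (3 * l c) 0 (cst 0) (cst 0)).
  have E2 : l \o f^`() = (fun y : R => 0 + 0 * y + (3 * l c) * y ^+ 2 + 0 * y ^+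
    3 - cst 0 y).
    by rewrite E1; apply/funext => z /=; ring.
  have := @derive_val _ _ _ _ _ _ _ (d2 x); rewrite E2 (@derive_val _ _ _ _ _ _ _ h).
  by rewrite lZ => E3; rewrite -[LHS]E3; ring.
rewrite (funext f2E) (_ : lipschitz_seminorm _ = (6 * `|c|)%:E)//.
apply/eqP; rewrite eq_le; apply/andP; split.
  apply: ge_ereal_sup => _ [[x y] /= xy <-].
  rewrite lee_fin -scalerBl -mulrBr normrZ normrM ler_pdivrMr ?normr_gt0 ?subr_eq0//.
  by rewrite normr_nat mulrAC.
apply: ereal_sup_ubound; exists (1, 0) => /=; first exact: oner_neq0.
by rewrite mulr0 scale0r !subr0 mulr1 normrZ normr1 divr1 normr_nat.
Qed.

End cube.

Unset Implicit Arguments.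

Theorem theorem1p2 (R : realType) (n : nat) (P : 'I_n -> law R)
    (E : banachSpace R) (f : R -> E) :
  (0 < n)%N -> (forall i, P3 (P i)) -> C21 f ->
  let sigma_ i := stddev (P i) in
  let Q i := symmetric_law (sigma_ i) in
  let sigma := Num.sqrt (\sum_(i < n) sigma_ i ^+ 2) in
  let rho i := std_abs_moment3 (P i) in
  let Pn := standardize (convolutions P) in
  let Qn := standardize (convolutions Q) in
  let lhs := `|bochner_integral Pn f - bochner_integral Qn f| in
  let rhs := fine (lipschitz_seminorm f^`(2)) / 6 *
             \sum_(i < n) sigma_ i ^+ 3 / sigma ^+ 3 * B (rho i) in
  [/\ bochner_integrable Pn f,
      bochner_integrable Qn f,
      lhs <= rhs
    & (forall i, two_point_law (P i)) ->
      (forall i, 0 <= centred_moment3 (P i)) \/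
      (forall i, centred_moment3 (P i) <= 0) ->
      (exists c : E, forall x, f x = x ^+ 3 *: c) ->
      lhs = rhs].
Proof.
move=> n0 P3P Cf sigma_ Q sigma rho Pn Qn lhs rhs.
have fPn : finite_moment3 Pn.
  apply: finite_moment3_standardize; apply: finite_moment3_convolutions => i.
  exact: P3_finite_moment3.
have fQn : finite_moment3 Qn.
  apply: finite_moment3_standardize; apply: finite_moment3_convolutions => i.
  exact: finite_moment3_symmetric_law.
have [df _ _ _] := Cf.
have cf : continuous f.
  by move=> x; apply/differentiable_continuous/derivable1_diffP.
have bP := continuous_bochner_integrable fPn cf (C21_cubic_growth Cf).
have bQ := continuous_bochner_integrable fQn cf (C21_cubic_growth Cf).
have L0 := lipschitz_seminorm_ge0 f^`(2).
(* [bochner_integral] chooses its value by [xget]; the integrability just proved ensures that this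
   value is an integral. *)
have lI l : contractive_functional l ->
    l (bochner_integral Pn f) = \int[Pn]_x l (f x) /\
    l (bochner_integral Qn f) = \int[Qn]_x l (f x).
  move=> hl; have gg := cubic_smooth_growth L0 (functional_cubic_smooth hl Cf).
  split; apply: functional_bochner => //; try exact: integrable_cubic_growth.
    exact: xgetPex bP.
  exact: xgetPex bQ.
split=> //.
  rewrite /lhs; have [l [lD lZ ll <-]] :=
    norming_functional (bochner_integral Pn f - bochner_integral Qn f).
  have hl : contractive_functional l by [].
  rewrite functionalB//; have [-> ->] := lI _ hl.
  exact: (standardized_convolution_le n0 P3P L0 (functional_cubic_smooth hl Cf)).
move=> two sgn [c fE].
have [mP mQ] := standardized_convolution_moment3 P3P.
have c3 := @cubic_growth_expr R 3 isT.
(* For [f x = x ^ 3 c] only the third moments of the two standardized laws matter. *)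
have cube_int (S : law R) I : finite_moment3 S ->
    (forall l, contractive_functional l -> l I = \int[S]_x l (f x)) ->
    I = (\int[S]_x (x ^+ 3)) *: c.
  move=> fS lIS; apply: functional_separates => l hl; rewrite lIS//.
  have [_ lZ _] := hl; rewrite lZ mulrC -RintegralZ_growth//.
  by apply: eq_Rintegral => x _; rewrite fE lZ mulrC.
rewrite /lhs /rhs (cube_int _ _ fPn (fun l hl => (lI l hl).1)).
rewrite (cube_int _ _ fQn (fun l hl => (lI l hl).2)).
rewrite mP mQ scale0r subr0 (cube_lipschitz_seminorm Cf fE) normrZ normrM.
have sig0 : 0 <= sigma^-1 ^+ 3 by rewrite exprn_ge0// invr_ge0 sqrtr_ge0.
rewrite -exprVn (ger0_norm sig0).
(* The common sign of the centred third moments is used here: the absolute value of their sum is the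
   sum of their absolute values. *)
have -> : `|\sum_(i < n) centred_moment3 (P i)| =
    \sum_(i < n) sigma_ i ^+ 3 * B (rho i).
  under [RHS]eq_bigr do rewrite -two_point_centred_moment3//.
  case: sgn => sgn.
    rewrite ger0_norm ?sumr_ge0//.
    by apply: eq_bigr => i _; rewrite ger0_norm.
  rewrite ler0_norm ?sumr_le0// -sumrN.
  by apply: eq_bigr => i _; rewrite ler0_norm.
rewrite (_ : 6 * `|c| / 6 = `|c|); last by field.
rewrite mulrC; congr (_ * _); rewrite mulr_suml; apply: eq_bigr => i _.
by rewrite exprVn; ring.
Qed.
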